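(* Let $n\ge 4$ and let $A$ be a real symmetric positive definite $n\times n$ matrix all of whose eigenvalues are simple (i.e. $\mathcal{E}_A$ is multi-axial). Then $\mathcal{E}_A=\{x\in\mathbb{R}^n:\langle A^{-1}x,x\rangle=1\}$, with the Riemannian metric induced from $\mathbb{R}^n$, has no self-focal points.
   Context: A point $x_0$ of a Riemannian manifold $M$ is self-focal if there exists a time $T>0$ such that $\exp_{x_0}(T\xi)=x_0$ for all unit (co)vectors $\xi\in S^*_{x_0}M$. *)

(* Defs.v *)
From mathcomp Require Import all_boot all_order all_algebra.
From mathcomp Require Import all_classical all_reals all_analysis.

Set Implicit Arguments.
Unset Strict Implicit.
Unset Printing Implicit Defensive.

Import Order.TTheory GRing.Theory Num.Theory.
Import numFieldNormedType.Exports.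

Local Open Scope classical_set_scope.
Local Open Scope ring_scope.

(* The library norm on matrices is the sup norm, hence this explicit Euclidean
   inner product; unit vectors are those with [dot xi xi = 1]. *)
Definition dot (R : realType) (n : nat) (x y : 'cV[R]_n) : R :=
  \sum_(i < n) x i 0 * y i 0.

Definition positive_definite (R : realType) (n : nat) (A : 'M[R]_n) : Prop :=
  forall x : 'cV[R]_n, x != 0 -> 0 < dot (A *m x) x.

Definition simple_eigenvalues (R : realType) (n : nat) (A : 'M[R]_n) : Prop :=
  forall a : R, eigenvalue A a -> mup a (char_poly A) = 1%N.

Definition ellipsoid (R : realType) (n : nat) (A : 'M[R]_n) : set 'cV[R]_n :=
  [set x | dot (invmx A *m x) x = 1].

(* Below, [M] is a closed (i.e. compact, boundaryless) submanifold of R^n with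
   the metric induced by [dot].  The definitions make sense for any set but are
   only meaningful in that case. *)

(* Velocities at [x] of curves drawn on [M]. *)
Definition tangent (R : realType) (n : nat) (M : set 'cV[R]_n)
    (x : 'cV[R]_n) : set 'cV[R]_n :=
  [set v | exists c : R -> 'cV[R]_n,
     [/\ \forall t \near (0 : R), M (c t), c 0 = x & is_derive (0 : R) 1 c v]].

(* [u] is the orthogonal projection of [w] on the tangent space of [M] at [x]. *)
Definition tangential_part (R : realType) (n : nat) (M : set 'cV[R]_n)
    (x w u : 'cV[R]_n) : Prop :=
  tangent M x u /\ forall v, tangent M x v -> dot (w - u) v = 0.

(* The Levi-Civita covariant derivative of a tangent field along a curve of [M]
   is the tangential part of its derivative in R^n, so the last clause says
   that the covariant derivative of the velocity vanishes.  Geodesics are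
   defined for all times, as [M] is complete. *)
Definition geodesic (R : realType) (n : nat) (M : set 'cV[R]_n)
    (g : R -> 'cV[R]_n) : Prop :=
  [/\ forall t : R, M (g t),
      forall t : R, derivable g t 1,
      forall t : R, derivable (derive1 g) t 1
    & forall t : R, tangential_part M (g t) (derive1 (derive1 g) t) 0].

(* The default value 0 is returned only when [x] is not in [M] or [v] is not
   tangent to [M] at [x]; otherwise the geodesic exists and is unique. *)
Definition exp_map (R : realType) (n : nat) (M : set 'cV[R]_n)
    (x v : 'cV[R]_n) : 'cV[R]_n :=
  xget 0 [set y | exists g : R -> 'cV[R]_n,
    [/\ geodesic M g, g 0 = x, derive1 g 0 = v & g 1 = y]].

(* Unit covectors are identified with unit tangent vectors by the metric. *)
Definition self_focal (R : realType) (n : nat) (M : set 'cV[R]_n)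
    (x0 : 'cV[R]_n) : Prop :=
  M x0 /\ exists T : R, 0 < T /\
    forall xi : 'cV[R]_n, tangent M x0 xi -> dot xi xi = 1 ->
      exp_map M x0 (T *: xi) = x0.

(* Main.v *)
(* In coordinates diagonalising [A] the ellipsoid is [sum x_i^2 / a_i = 1] and
   a geodesic satisfies [x_i'' = - (l / a_i) x_i] with a single multiplier
   [l > 0].  Fix an axis [j] that is neither the shortest nor the longest, write
   [y = x_j], [v = y'], and, summing over [i != j], put
     [P = 1 + sum x_i^2 / (a_j - a_i)],  [Q = sum x_i x_i' / (a_j - a_i)],
     [S = sum x_i'^2 / (a_j - a_i)].
   Joachimsthal's integral [F = P v^2 - 2 Q y v + S y^2] is conserved.

   If [y <> 0] at [x0], some unit tangent vector at [x0] has [F = 0].  Along a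
   geodesic with [F = 0] the function [u = (P v - Q y) / y] extends smoothly
   through the zeros of [y] and has derivative [- l y^2 / a_j^2].  Hence every
   return to [x0] lowers [u] by a fixed amount, although [u] is bounded on the
   unit tangent vectors at [x0]: such an [x0] is not self-focal.

   Otherwise [x0] lies in the plane of the two extreme axes, and as [n >= 4]
   some [j] has [P <> 0] at [x0].  Consider the geodesics leaving [x0] nearly
   along the ellipse in that plane, with [v] of size [e] at the start.  To first
   order in [e], [y] is a Jacobi field along the ellipse, [w = P v - Q y] is
   another solution of the same equation, and [p = w + k y] with
   [k^2 = Q^2 - P S > 0] satisfies [P p' - Q p = k p].  The quadratic form
   [sum (x_i p' - p x_i')^2 / (a_j - a_i)^2] then has derivative
   [2 l k p^2 / a_j^2], of order [e^2], up to an error of order [e^4]; but a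
   return to [x0] forces it to take the same value at both ends. *)
Require Import Defs.
From mathcomp Require Import all_boot all_order all_algebra.
From mathcomp Require Import all_classical all_reals all_analysis.
From mathcomp Require Import ring lra.
From mathcomp Require spectral.
From mathcomp.real_closed Require complex.

Set Implicit Arguments.
Unset Strict Implicit.
Unset Printing Implicit Defensive.

Import Order.TTheory GRing.Theory Num.Theory.
Import numFieldNormedType.Exports.

Local Open Scope classical_set_scope.
Local Open Scope ring_scope.

(** * Derivative rules and mean value inequalities for real functions of one variable *)

Section PointwiseRules.
Variable R : realType.
Implicit Types (f g : R -> R) (t : R).

Lemma is_derive_eqf f t a b : is_derive t 1 f a -> a = b -> is_derive t 1 f b.
Proof. by move=> ? <-. Qed.

Lemma is_derive_cstf (c t : R) : is_derive t 1 (fun=> c) 0.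
Proof. exact: is_derive_cst. Qed.

Lemma is_derive_addf f g t df dg : is_derive t 1 f df -> is_derive t 1 g dg ->
  is_derive t 1 (fun s => f s + g s) (df + dg).
Proof. exact: is_deriveD. Qed.

Lemma is_derive_oppf f t df : is_derive t 1 f df ->
  is_derive t 1 (fun s => - f s) (- df).
Proof. exact: is_deriveN. Qed.

Lemma is_derive_mulf f g t df dg : is_derive t 1 f df -> is_derive t 1 g dg ->
  is_derive t 1 (fun s => f s * g s) (f t * dg + g t * df).
Proof. exact: is_deriveM. Qed.

Lemma is_derive_sqrf f t df : is_derive t 1 f df ->
  is_derive t 1 (fun s => f s ^+ 2) (2 * f t * df).
Proof.
move=> h; rewrite (_ : (fun s => _) = (fun s => f s * f s)).
  by apply: (is_derive_eqf (is_derive_mulf h h)); ring.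
by apply/funext => s; rewrite expr2.
Qed.

Lemma is_derive_invf f t df : f t != 0 -> is_derive t 1 f df ->
  is_derive t 1 (fun s => (f s)^-1) (- (f t) ^- 2 * df).
Proof. by move=> f0 h; apply: (is_derive_eqf (is_deriveV f0 h)). Qed.

Lemma is_derive_sumf n (h : 'I_n -> R -> R) (dh : 'I_n -> R) t :
  (forall i, is_derive t 1 (h i) (dh i)) ->
  is_derive t 1 (fun s => \sum_i h i s) (\sum_i dh i).
Proof.
by move=> H; rewrite -[fun s => _](fct_sumE (index_enum 'I_n) predT h);
  exact: is_derive_sum.
Qed.

Lemma is_derive_uniq f t a b : is_derive t 1 f a -> is_derive t 1 f b -> a = b.
Proof. by move=> /@derive_val <- /@derive_val <-. Qed.

Lemma derivE_continuous f df : (forall t : R, is_derive t 1 f (df t)) ->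
  continuous f.
Proof.
move=> h t; apply: differentiable_continuous.
by apply/derivable1_diffP; case: (h t).
Qed.

Lemma derivative0_const f : (forall t : R, is_derive t 1 f 0) ->
  forall s t, f s = f t.
Proof. by move=> h s t; exact: is_derive_0_is_cst. Qed.

Lemma mvt_le f df c a b : (forall t : R, is_derive t 1 f (df t)) -> a <= b ->
  (forall t, a <= t <= b -> c <= df t) -> c * (b - a) <= f b - f a.
Proof.
move=> h ab H.
have cf : {within `[a, b], continuous f}.
  by apply: continuous_subspaceT; exact: (derivE_continuous h).
have [t + ->] := MVT_segment ab (fun x _ => h x) cf.
by rewrite in_itv /= => tab; rewrite ler_wpM2r ?subr_ge0 // H.
Qed.

Lemma mvt_ge f df c a b : (forall t : R, is_derive t 1 f (df t)) -> a <= b ->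
  (forall t, a <= t <= b -> df t <= c) -> f b - f a <= c * (b - a).
Proof.
move=> h ab H.
have h' t : is_derive t 1 (fun s => - f s) (- df t) by exact: is_derive_oppf.
have := mvt_le (c := - c) h' ab; rewrite mulNr -opprD lerN2; apply.
by move=> t /H; rewrite lerN2.
Qed.

End PointwiseRules.

(* [notypeclasses] keeps the instances of [is_derive] from producing
   derivatives of another syntactic form, that [ring] does not see through. *)
Ltac deriv :=
  notypeclasses refine (is_derive_eqf _ _);
  [ repeat first
    [ match goal with H : forall t, is_derive t 1 ?f _ |- is_derive _ 1 _ _ =>
        notypeclasses refine (H _) end
    | notypeclasses refine (is_derive_cstf _ _)
    | notypeclasses refine (is_derive_addf _ _)
    | notypeclasses refine (is_derive_oppf _)
    | notypeclasses refine (is_derive_sqrf _)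
    | notypeclasses refine (is_derive_mulf _ _) ]
  | rewrite /=].

(** * Weighted sums and the geodesic equation in principal coordinates *)

Section Moments.
Variables (R : realType) (n : nat).
Implicit Types m x y : 'I_n -> R.

Definition mom m x y : R := \sum_i m i * x i * y i.

Lemma momC m x y : mom m x y = mom m y x.
Proof. by apply: eq_bigr => i _; ring. Qed.

Lemma momD m p x y : mom (fun i => m i + p i) x y = mom m x y + mom p x y.
Proof. by rewrite -big_split; apply: eq_bigr => i _ /=; ring. Qed.

Lemma momM c m x y : mom (fun i => c * m i) x y = c * mom m x y.
Proof. by rewrite mulr_sumr; apply: eq_bigr => i _ /=; ring. Qed.

Lemma mom_comb m c d x y z :
  mom m (fun i => c * x i + d * y i) z = c * mom m x z + d * mom m y z.
Proof. by rewrite !mulr_sumr -big_split; apply: eq_bigr => i _ /=; ring. Qed.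

Lemma mom_sqr m c d x y :
  mom m (fun i => c * x i + d * y i) (fun i => c * x i + d * y i) =
  c ^+ 2 * mom m x x + 2 * c * d * mom m x y + d ^+ 2 * mom m y y.
Proof.
by rewrite mom_comb (momC m x) (momC m y) !mom_comb (momC m y x); ring.
Qed.

Lemma mom_ge0 m x : (forall i, 0 <= m i) -> 0 <= mom m x x.
Proof.
move=> m0; apply: sumr_ge0 => i _.
by rewrite -mulrA; apply: mulr_ge0 => //; rewrite -expr2 sqr_ge0.
Qed.

Lemma mom_le m p x : (forall i, m i <= p i) -> mom m x x <= mom p x x.
Proof.
move=> mp; apply: ler_sum => i _.
by rewrite -!mulrA; apply: ler_wpM2r => //; rewrite -expr2 sqr_ge0.
Qed.

Lemma mom_bound m x y C : (forall i, `|x i| <= C) -> (forall i, `|y i| <= C) ->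
  `|mom m x y| <= (\sum_i `|m i|) * C ^+ 2.
Proof.
move=> hx hy; rewrite (le_trans (ler_norm_sum _ _ _)) // mulr_suml.
apply: ler_sum => i _; rewrite !normrM -mulrA ler_wpM2l // expr2.
by rewrite ler_pM.
Qed.

End Moments.

Section Flow.
Variables (R : realType) (n : nat) (a : 'I_n -> R).
Hypothesis a_gt0 : forall i, 0 < a i.
Implicit Types (X V : 'I_n -> R -> R) (l : R -> R).

(** First-order form of the geodesic equation, [l] being the Lagrange multiplier of the constraint
    in the last clause. Differentiating that clause once gives [flow_tangent], and twice
    [flow_mult], which determines [l]. *)
Definition flow X V l :=
  [/\ forall i (t : R), is_derive t 1 (X i) (V i t),
      forall i (t : R), is_derive t 1 (V i) (- (l t / a i) * X i t)
    & forall t, mom (fun i => (a i)^-1) (X ^~ t) (X ^~ t) = 1].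

Variables (X V : 'I_n -> R -> R) (l : R -> R).
Hypothesis XV : flow X V l.

Notation xx m t := (mom m (X ^~ t) (X ^~ t)).
Notation xv m t := (mom m (X ^~ t) (V ^~ t)).
Notation vv m t := (mom m (V ^~ t) (V ^~ t)).

Lemma dxx m (t : R) : is_derive t 1 (fun s => xx m s) (2 * xv m t).
Proof.
case: XV => dX _ _.
apply: (is_derive_eqf (is_derive_sumf (dh := fun i => 2 * m i * X i t * V i t) _)).
  by move=> i; have dXi := dX i; deriv; ring.
by rewrite mulr_sumr; apply: eq_bigr => i _; ring.
Qed.

Lemma dxv m (t : R) :
  is_derive t 1 (fun s => xv m s) (vv m t - l t * xx (fun i => m i / a i) t).
Proof.
case: XV => dX dV _.
apply: (is_derive_eqf (is_derive_sumf (dh := fun i =>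
  m i * V i t * V i t - l t * (m i / a i * X i t * X i t)) _)).
  by move=> i; have dXi := dX i; have dVi := dV i; deriv; ring.
by rewrite sumrB -mulr_sumr.
Qed.

Lemma dvv m (t : R) :
  is_derive t 1 (fun s => vv m s) (- 2 * l t * xv (fun i => m i / a i) t).
Proof.
case: XV => dX dV _.
apply: (is_derive_eqf (is_derive_sumf (dh := fun i =>
  - 2 * l t * (m i / a i * X i t * V i t)) _)).
  by move=> i; have dXi := dX i; have dVi := dV i; deriv; ring.
by rewrite -mulr_sumr.
Qed.

Lemma flow_tangent t : xv (fun i => (a i)^-1) t = 0.
Proof.
have [_ _ h] := XV.
have := dxx (fun i => (a i)^-1) t.
rewrite (_ : (fun s => _) = fun=> 1); last by apply/funext => s; exact: h.
by move=> /is_derive_uniq/(_ (is_derive_cstf _ _))/eqP; rewrite mulf_eq0 pnatr_eq0 => /eqP.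
Qed.

Lemma flow_mult t :
  l t * xx (fun i => (a i)^-1 / a i) t = vv (fun i => (a i)^-1) t.
Proof.
have := dxv (fun i => (a i)^-1) t.
rewrite (_ : (fun s => _) = fun=> 0); last by apply/funext => s; exact: flow_tangent.
by move=> /is_derive_uniq/(_ (is_derive_cstf _ _))/eqP; rewrite subr_eq0 => /eqP.
Qed.

(** The acceleration is normal to the ellipsoid, hence orthogonal to the velocity. *)
Lemma flow_speed s t : vv (fun=> 1) s = vv (fun=> 1) t.
Proof.
apply: (derivative0_const (f := fun s => vv (fun=> 1) s)) => {}t.
apply: (is_derive_eqf (dvv _ t)).
rewrite (_ : (fun i => 1 / a i) = fun i => (a i)^-1); last first.
  by apply/funext => i; rewrite div1r.
by rewrite flow_tangent mulr0.
Qed.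

Lemma flow_x_bound i t : X i t ^+ 2 <= a i.
Proof.
have [_ _ /(_ t) h] := XV.
rewrite -(ler_pM2l (_ : 0 < (a i)^-1)) ?invr_gt0 // mulVf ?gt_eqF // -h.
rewrite /mom (bigD1 i) //= expr2 mulrA lerDl; apply: sumr_ge0 => k _.
by rewrite -mulrA -expr2 mulr_ge0 ?invr_ge0 ?sqr_ge0 // ltW.
Qed.

Lemma flow_v_bound i t : V i t ^+ 2 <= vv (fun=> 1) 0.
Proof.
rewrite (flow_speed 0 t) {1}/mom (bigD1 i) //= mul1r -expr2 lerDl.
by apply: sumr_ge0 => k _; rewrite mul1r -expr2 sqr_ge0.
Qed.

(** By [flow_mult], [l t] is a quotient [r / q]: the constraint encloses [q] and the constant speed
    encloses [r]. The bounds depend on the geodesic through its speed only. *)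
Lemma flow_mult_bounds (c C t : R) : 0 < c -> (forall i, c <= a i) ->
  (forall i, a i <= C) -> 
  vv (fun=> 1) 0 * c / C <= l t <= vv (fun=> 1) 0 * C / c.
Proof.
move=> c0 hc hC.
have C0 (i : 'I_n) : 0 < C by exact: lt_le_trans (a_gt0 i) (hC i).
have [_ _ /(_ t) h] := XV; have hm := flow_mult t.
set q := mom _ _ _ in hm; set r := mom _ _ _ in hm.
have qle : q <= c^-1.
  rewrite -[leRHS]mulr1 -h -momM; apply: mom_le => i.
  by rewrite mulrC ler_wpM2r ?invr_ge0 ?(ltW (a_gt0 _)) // lef_pV2 ?posrE.
have qge : C^-1 <= q.
  rewrite -[leLHS]mulr1 -h -momM; apply: mom_le => i.
  by rewrite mulrC ler_wpM2l ?invr_ge0 ?(ltW (a_gt0 _)) // lef_pV2 ?posrE // (C0 i).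
set E := vv (fun=> 1) 0.
have E0 : 0 <= E by apply: mom_ge0.
have rle : r <= E / c.
  rewrite /E (flow_speed 0 t) mulrC -momM; apply: mom_le => i.
  by rewrite mulr1 lef_pV2 ?posrE.
have rge : E / C <= r.
  rewrite /E (flow_speed 0 t) mulrC -momM; apply: mom_le => i.
  by rewrite mulr1 lef_pV2 ?posrE // (C0 i).
(* An index is needed to get [0 < C]; without one the constraint would read [0 = 1]. *)
have [i0 _|noi] := pickP (@predT 'I_n); last first.
  by move/eqP: h; rewrite /mom big_pred0 // eq_sym oner_eq0.
have Cp := C0 i0.
have Ci : 0 < C^-1 by rewrite invr_gt0.
have q0 : 0 < q by exact: lt_le_trans qge.
have l0 : 0 <= l t.
  rewrite -(pmulr_lge0 _ q0) hm; apply: mom_ge0 => i.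
  by rewrite invr_ge0 ltW.
have h1 : E / C <= l t / c.
  by rewrite (le_trans rge) // -hm ler_wpM2l.
have h2 : l t / C <= E / c.
  by rewrite (le_trans _ rle) // -hm ler_wpM2l.
apply/andP; split.
  by move: h1; rewrite ler_pdivlMr // mulrAC.
by move: h2; rewrite ler_pdivrMr // mulrAC.
Qed.

End Flow.

(** * Joachimsthal's integrals *)

Section Joachimsthal.
Variables (R : realType) (n : nat) (a : 'I_n -> R).
Hypothesis a_gt0 : forall i, 0 < a i.
Hypothesis a_inj : injective a.
Variable j : 'I_n.

Let aj0 : a j != 0. Proof. by rewrite gt_eqF. Qed.

(* The junk value [gap j = 0] drops the [j]th term of the sums below. *)
Definition gap (i : 'I_n) : R := (a j - a i)^-1.

(** Partial fractions: [1 / ((a j - a i) * a i)] is [(1 / a i + 1 / (a j - a i)) / a j]. At [i = j]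
    the left side is zero by the junk value of [gap], and the last term compensates for the right
    side. *)
Lemma gap_mom x y : mom (fun i => gap i / a i) x y =
  (mom (fun i => (a i)^-1) x y + mom gap x y) / a j - x j * y j / a j ^+ 2.
Proof.
have -> : x j * y j / a j ^+ 2 =
    \sum_i (if i == j then (a j ^+ 2)^-1 * x i * y i else 0).
  by rewrite -big_mkcond big_pred1_eq; ring.
rewrite -momD mulrC -momM -sumrB; apply: eq_bigr => i _ /=.
case: eqVneq => [->|ij]; rewrite /gap.
  by rewrite subrr invr0; field.
field; rewrite subr_eq0 (gt_eqF (a_gt0 i)) aj0 /= andbT.
by apply: contra ij => /eqP/a_inj ->.
Qed.

Lemma gap2_mom x y : mom (fun i => gap i ^+ 2 / a i) x y =
  mom (fun i => gap i ^+ 2) x y / a j + mom (fun i => gap i / a i) x y / a j.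
Proof.
rewrite -mulrDl -momD mulrC -momM; apply: eq_bigr => i _ /=.
have [->|ij] := eqVneq i j; rewrite /gap.
  by rewrite subrr invr0; ring.
field; rewrite subr_eq0 (gt_eqF (a_gt0 i)) aj0 /= andbT.
by apply: contra ij => /eqP/a_inj ->.
Qed.

Variables (X V : 'I_n -> R -> R) (l : R -> R).
Hypothesis XV : flow a X V l.

(* [P], [Q], [S] as in the header; [jP2], [jQ2], [jS2] are the coefficients
   of the quadratic form used near the extreme plane. *)
Definition jP t := 1 + mom gap (X ^~ t) (X ^~ t).
Definition jQ t := mom gap (X ^~ t) (V ^~ t).
Definition jS t := mom gap (V ^~ t) (V ^~ t).
Definition jP2 t := mom (fun i => gap i ^+ 2) (X ^~ t) (X ^~ t).
Definition jQ2 t := mom (fun i => gap i ^+ 2) (X ^~ t) (V ^~ t).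
Definition jS2 t := mom (fun i => gap i ^+ 2) (V ^~ t) (V ^~ t).

Lemma djP (t : R) : is_derive t 1 jP (2 * jQ t).
Proof.
have h := dxx XV gap; have hc := is_derive_cstf (1 : R).
by apply: (is_derive_eqf (is_derive_addf (hc t) (h t))); rewrite add0r.
Qed.

Lemma djQ (t : R) : is_derive t 1 jQ
  (jS t - l t / a j * (jP t - X j t ^+ 2 / a j)).
Proof.
apply: (is_derive_eqf (dxv XV gap t)); rewrite gap_mom.
by case: XV => _ _ ->; rewrite /jS /jP; field.
Qed.

Lemma djS (t : R) : is_derive t 1 jS
  (- 2 * (l t / a j) * (jQ t - X j t * V j t / a j)).
Proof.
apply: (is_derive_eqf (dvv XV gap t)); rewrite gap_mom (flow_tangent XV).
by rewrite /jQ; field.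
Qed.

Lemma djP2 (t : R) : is_derive t 1 jP2 (2 * jQ2 t).
Proof. exact: dxx XV _ t. Qed.

Lemma djQ2 (t : R) : is_derive t 1 jQ2
  (jS2 t - l t / a j * (jP2 t + (jP t - X j t ^+ 2 / a j) / a j)).
Proof.
apply: (is_derive_eqf (dxv XV _ t)); rewrite gap2_mom gap_mom.
by case: XV => _ _ ->; rewrite /jS2 /jP2 /jP; field.
Qed.

Lemma djS2 (t : R) : is_derive t 1 jS2
  (- 2 * (l t / a j) * (jQ2 t + (jQ t - X j t * V j t / a j) / a j)).
Proof.
apply: (is_derive_eqf (dvv XV _ t)); rewrite gap2_mom gap_mom (flow_tangent XV).
by rewrite /jQ2 /jQ; field.
Qed.

(* Equal to [v_j^2 + sum (x_j v_i - x_i v_j)^2 / (a_j - a_i)], the sum over [i != j]. *)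
Definition jF t := jP t * V j t ^+ 2 - 2 * jQ t * X j t * V j t + jS t * X j t ^+ 2.

Lemma djF (t : R) : is_derive t 1 jF 0.
Proof.
case: XV => dX dV _; have dy := dX j; have dv := dV j.
have := djP; have := djQ; have := djS; rewrite /jF => d1 d2 d3.
by deriv; field.
Qed.

(** Up to terms of degree three in [(X j, V j)], the pair [(jw, jz)] solves the same linear system
    as [(X j, V j)]. The Wronskian [jw * V j - jz * X j] of the two pairs is [jF]. *)
Definition jw t := jP t * V j t - jQ t * X j t.
Definition jz t := jQ t * V j t - jS t * X j t.

Lemma djw (t : R) : is_derive t 1 jw (jz t - l t / a j ^+ 2 * X j t ^+ 3).
Proof.
case: XV => dX dV _; have dy := dX j; have dv := dV j.
have := djP; have := djQ; have := djS; rewrite /jw /jz => d1 d2 d3.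
by deriv; field.
Qed.

Lemma djz (t : R) : is_derive t 1 jz
  (- (l t / a j) * jw t - l t / a j ^+ 2 * X j t ^+ 2 * V j t).
Proof.
case: XV => dX dV _; have dy := dX j; have dv := dV j.
have := djP; have := djQ; have := djS; rewrite /jw /jz => d1 d2 d3.
by deriv; field.
Qed.

(* On [jF = 0] the vectors [(jw, jz)] and [(X j, V j)] are parallel and [ju] is
   their ratio. *)
Definition ju t := (jw t * X j t + jz t * V j t) / (X j t ^+ 2 + V j t ^+ 2).

Lemma ju_w t : X j t ^+ 2 + V j t ^+ 2 != 0 -> jF t = 0 ->
  ju t * X j t = jw t /\ ju t * V j t = jz t.
Proof.
move=> r0 F0; have wz : jw t * V j t = jz t * X j t.
  by apply/eqP; rewrite -subr_eq0 -[0]F0 /jw /jz /jF; apply/eqP; ring.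
split; rewrite /ju mulrAC; apply: (canLR (mulfK r0)).
  transitivity (jw t * X j t ^+ 2 + jz t * X j t * V j t); first by ring.
  by rewrite -wz; ring.
transitivity (jw t * V j t * X j t + jz t * V j t ^+ 2); first by ring.
by rewrite wz; ring.
Qed.

(** For parallel pairs the linear parts of the two systems cancel in the derivative of the ratio, so
    only the cubic terms remain. The denominator of [ju] makes this valid at the zeros of [X j]
    too. *)
Lemma dju (t : R) : X j t ^+ 2 + V j t ^+ 2 != 0 -> jF t = 0 ->
  is_derive t 1 ju (- (l t / a j ^+ 2) * X j t ^+ 2).
Proof.
move=> r0 F0; have [hw hz] := ju_w r0 F0.
case: XV => dX dV _; have dy := dX j; have dv := dV j.
have dw := djw; have dz := djz.
have dr : is_derive t 1 (fun s => X j s ^+ 2 + V j s ^+ 2)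
    (2 * X j t * V j t * (1 - l t / a j)).
  by deriv; field.
have dn : is_derive t 1 (fun s => jw s * X j s + jz s * V j s)
    (jw t * V j t + jz t * X j t - l t / a j ^+ 2 * X j t ^+ 4
     - l t / a j * (jw t * V j t + jz t * X j t)
     - l t / a j ^+ 2 * X j t ^+ 2 * V j t ^+ 2).
  by deriv; field.
have di := is_derive_invf (f := fun s => X j s ^+ 2 + V j s ^+ 2) r0 dr.
have dm := is_derive_mulf dn di.
refine (is_derive_eqf dm _).
rewrite /= -hw -hz.
by field; rewrite aj0 r0.
Qed.

Definition jD t := jQ t ^+ 2 - jP t * jS t.

(* [sum (x_i q - p x_i')^2 / (a_j - a_i)^2] *)
Definition jNf t p q := q ^+ 2 * jP2 t - 2 * p * q * jQ2 t + p ^+ 2 * jS2 t.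

(** [jD] varies only by [jNf] at [(X j, V j)], which is quadratic in the deviation from the plane;
    hence [k] can be frozen at its initial value. *)
Lemma djD (t : R) : is_derive t 1
  (fun s => jD s + jNf s (X j s) (V j s)) 0.
Proof.
case: XV => dX dV _; have dy := dX j; have dv := dV j.
have := djP; have := djQ; have := djS; have := djP2; have := djQ2; have := djS2.
rewrite /jD /jNf => d1 d2 d3 d4 d5 d6.
by deriv; field.
Qed.

(** The first term has the sign of [k] when [l] is positive. Once [djD] shows [jD - k ^ 2] to be of
    second order in the deviation, all the others are of fourth order. *)
Lemma djN (k t : R) :
  let p s := jw s + k * X j s in let q s := jz s + k * V j s in
  is_derive t 1 (fun s => jNf s (p s) (q s))
   (2 * l t / a j ^+ 2 * k * p t ^+ 2 +
    2 * l t / a j ^+ 2 *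
     (p t * ((jD t - k ^+ 2) * X j t
             - X j t / a j * (X j t * q t - p t * V j t))
      + X j t ^+ 2 * (q t * X j t * jQ2 t - q t * V j t * jP2 t
             - p t * X j t * jS2 t + p t * V j t * jQ2 t))).
Proof.
move=> p q.
case: XV => dX dV _; have dy := dX j; have dv := dV j.
have dw := djw; have dz := djz.
have := djP2; have := djQ2; have := djS2.
rewrite /jD /jNf /p /q => d1 d2 d3.
deriv; rewrite /jw /jz.
by field.
Qed.

End Joachimsthal.

(** * Growth of oscillators with bounded frequency, and mean value bounds in absolute value *)

Section Gronwall.
Variable R : realType.
Implicit Types f y v m : R -> R.

Lemma is_derive_expRM (c t : R) :
  is_derive t 1 (fun s => expR (c * s)) (expR (c * t) * c).
Proof.
apply: (is_derive_eqf (is_derive1_comp (f := expR) (g := fun s => c * s) _ _)).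
by rewrite /GRing.scale /= mulr1.
Qed.

(** Multiplied by [expR (- K * s)] the function is nonincreasing, and by [expR (K * s)]
    nondecreasing; one serves each direction of time. *)
Lemma gronwall f df (K : R) : (forall t : R, is_derive t 1 f (df t)) ->
  (forall t, `|df t| <= K * f t) ->
  forall s t, f s <= f t * expR (K * `|s - t|).
Proof.
move=> hf hK.
have dg (e t : R) : is_derive t 1 (fun s => f s * expR (e * s))
    ((df t + e * f t) * expR (e * t)).
  by apply: (is_derive_eqf (is_derive_mulf (hf t) (is_derive_expRM e t))); ring.
move=> s t; have [ts|st] := leP t s.
  have := mvt_ge (dg (- K)) ts (c := 0) _; rewrite mul0r subr_le0 => h.
  rewrite -(ler_pM2r (expR_gt0 (- K * s))) -mulrA -expRD ger0_norm ?subr_ge0 //.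
  rewrite (_ : K * (s - t) + - K * s = - K * t); last by ring.
  apply: h => x _; rewrite pmulr_lle0 ?expR_gt0 // mulNr subr_le0.
  by rewrite (le_trans (ler_norm _)).
have := mvt_le (dg K) (ltW st) (c := 0) _; rewrite mul0r subr_ge0 => h.
rewrite -(ler_pM2r (expR_gt0 (K * s))) -mulrA -expRD distrC.
rewrite ger0_norm; last by rewrite subr_ge0 ltW.
rewrite (_ : K * (t - s) + K * s = K * t); last by ring.
apply: h => x _; rewrite pmulr_lge0 ?expR_gt0 // -lerBlDr sub0r lerNl.
by rewrite (le_trans _ (hK x)) // -normrN ler_norm.
Qed.

(** The derivative of [y ^ 2 + v ^ 2] is [2 * y * v * (1 - m)], and [2 * y * v] is at most
    [y ^ 2 + v ^ 2] in absolute value. Thus small data stay small, and zero data stay zero. *)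
Lemma oscillator_gronwall y v m (K : R) :
  (forall t : R, is_derive t 1 y (v t)) ->
  (forall t : R, is_derive t 1 v (- m t * y t)) ->
  (forall t, 0 <= m t <= K) ->
  forall s t, y s ^+ 2 + v s ^+ 2 <=
    (y t ^+ 2 + v t ^+ 2) * expR ((1 + K) * `|s - t|).
Proof.
move=> dy dv hm.
apply: (gronwall (f := fun s => y s ^+ 2 + v s ^+ 2)
  (df := fun s => 2 * (y s * v s) * (1 - m s))).
  by move=> t; deriv; ring.
move=> t; have /andP[m0 mK] := hm t.
rewrite normrM [leRHS]mulrC ler_pM //.
  rewrite ler_norml; apply/andP; split.
    by rewrite -subr_ge0 (_ : _ - _ = (y t + v t) ^+ 2) ?sqr_ge0 //; ring.
  by rewrite -subr_ge0 (_ : _ - _ = (y t - v t) ^+ 2) ?sqr_ge0 //; ring.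
by rewrite ler_norml; apply/andP; split; lra.
Qed.

End Gronwall.

Section MeanValueNorm.
Variable R : realType.

Lemma mvt_norm (f df : R -> R) C a b : (forall t : R, is_derive t 1 f (df t)) ->
  a <= b -> (forall t, a <= t <= b -> `|df t| <= C) ->
  `|f b - f a| <= C * (b - a).
Proof.
move=> h ab H; rewrite ler_norml -mulNr; apply/andP; split.
  by apply: (mvt_le h ab) => t /H; rewrite ler_norml => /andP[].
by apply: (mvt_ge h ab) => t /H; rewrite ler_norml => /andP[].
Qed.

Lemma le_norm_of_sqr (x b : R) : 0 <= b -> x ^+ 2 <= b ^+ 2 -> `|x| <= b.
Proof. by move=> b0; rewrite -[x ^+ 2]real_normK ?num_real // ler_sqr ?nnegrE. Qed.

End MeanValueNorm.

(** * Points off the hyperplane of a middle axis *)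

Section Returning.
Variables (R : realType) (n : nat) (a : 'I_n -> R).
Hypothesis a_gt0 : forall i, 0 < a i.
Hypothesis a_inj : injective a.

(** Self-focality in principal coordinates, with the time of return scaled to [1], so that [T]
    becomes the speed. *)
Definition returning (x0 : 'I_n -> R) (T : R) := forall v : 'I_n -> R,
  mom (fun i => (a i)^-1) x0 v = 0 -> mom (fun=> 1) v v = T ^+ 2 ->
  exists X V l, [/\ flow a X V l, X ^~ 0 = x0, V ^~ 0 = v & X ^~ 1 = x0].

Lemma axes_bounds (i0 : 'I_n) : exists c C, [/\ 0 < c, 0 < C,
  (forall i, c <= a i) & (forall i, a i <= C)].
Proof.
have ai i : 0 < (a i)^-1 by rewrite invr_gt0.
have s_ge (f : 'I_n -> R) i : (forall i, 0 < f i) -> f i <= \sum_k f k.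
  by move=> f0; rewrite (bigD1 i) //= lerDl sumr_ge0 // => k _; exact: ltW.
have s0 : 0 < \sum_k (a k)^-1 by exact: lt_le_trans (ai i0) (s_ge _ i0 ai).
exists (\sum_k (a k)^-1)^-1, (\sum_k a k); split => //.
- by rewrite invr_gt0.
- exact: lt_le_trans (a_gt0 i0) (s_ge _ i0 a_gt0).
- by move=> i; rewrite -[leRHS]invrK lef_pV2 ?posrE //; exact: s_ge.
- by move=> i; exact: s_ge.
Qed.

Variables (x0 : 'I_n -> R) (T : R).
Hypothesis T_gt0 : 0 < T.
Hypothesis x0_on : mom (fun i => (a i)^-1) x0 x0 = 1.
Variable j : 'I_n.

(* [F0] and [u0] are [jF] and [ju] at [x0], as functions of the velocity. *)
Definition F0 v := (1 + mom (gap a j) x0 x0) * v j ^+ 2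
  - 2 * mom (gap a j) x0 v * x0 j * v j + mom (gap a j) v v * x0 j ^+ 2.

Definition null v := [/\ mom (fun i => (a i)^-1) x0 v = 0,
  mom (fun=> 1) v v = T ^+ 2 & F0 v = 0].

Definition u0 (v : 'I_n -> R) :=
  (1 + mom (gap a j) x0 x0) * v j / x0 j - mom (gap a j) x0 v.

Lemma mom_delta (m y : 'I_n -> R) k : mom m (fun i => (i == k)%:R) y = m k * y k.
Proof.
rewrite /mom (bigD1 k) //= eqxx mulr1 big1 ?addr0 // => i /negPf ->.
by rewrite mulr0 mul0r.
Qed.

Lemma sqr_le_mom1 (v : 'I_n -> R) i : v i ^+ 2 <= mom (fun=> 1) v v :> R.
Proof.
rewrite /mom (bigD1 i) //= mul1r -expr2 lerDl.
by apply: sumr_ge0 => k _; rewrite mul1r -expr2 sqr_ge0.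
Qed.

Lemma sqr_le_axis i : x0 i ^+ 2 <= a i.
Proof.
rewrite -(ler_pM2l (_ : 0 < (a i)^-1)) ?invr_gt0 // mulVf ?gt_eqF // -x0_on.
rewrite /mom (bigD1 i) //= expr2 mulrA lerDl; apply: sumr_ge0 => k _.
by rewrite -mulrA -expr2 mulr_ge0 ?invr_ge0 ?sqr_ge0 // ltW.
Qed.

(* Writing [v_i = (z_i + v_j x_i) / x_j], tangency is [v_j = - sum x_i z_i / a_i]
   and [F] is [v_j^2 + sum z_i^2 / (a_j - a_i)].  With [z] supported on [k] and
   [m] this is an indefinite binary form, since [x_m^2 <= a_m]. *)
Lemma exists_null k m : a k < a j -> a j < a m -> x0 j != 0 -> exists v, null v.
Proof.
move=> akj ajm y0.
have km : k != m by apply/eqP => e; move: akj; rewrite e ltNge (ltW ajm).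
have jk : (j == k) = false by apply/eqP => e; rewrite e ltxx in akj.
have jm : (j == m) = false by apply/eqP => e; rewrite e ltxx in ajm.
pose al := x0 k / a k; pose be := x0 m / a m.
pose p := gap a j k; pose q := - gap a j m.
have p0 : 0 < p by rewrite invr_gt0 subr_gt0.
have bq : be ^+ 2 < q.
  rewrite /q -invrN opprB; apply: (@le_lt_trans _ _ (a m)^-1).
    rewrite expr_div_n ler_pdivrMr ?exprn_gt0 //.
    by rewrite expr2 mulrA mulVf ?gt_eqF // mul1r sqr_le_axis.
  by rewrite ltf_pV2 ?posrE ?subr_gt0 // gtrBl.
(* [s] is the entry of [z] at [k], its entry at [m] being [1]; [dlt] is a quarter of the
   discriminant of the equation [quad] in [s], nonnegative by [bq]. *)
pose dlt := (al * be) ^+ 2 - (al ^+ 2 + p) * (be ^+ 2 - q).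
have dlt0 : 0 <= dlt.
  rewrite subr_ge0 (le_trans _ (sqr_ge0 _)) //.
  by rewrite pmulr_rle0 ?subr_le0 ?(ltW bq) // ltr_wpDl ?sqr_ge0.
have ap0 : al ^+ 2 + p != 0 by rewrite gt_eqF // ltr_wpDl ?sqr_ge0.
pose s := (- (al * be) + Num.sqrt dlt) / (al ^+ 2 + p).
have quad : (al * s + be) ^+ 2 + p * s ^+ 2 = q.
  have e : (al ^+ 2 + p) * s = - (al * be) + Num.sqrt dlt.
    by rewrite mulrC divfK.
  have h : (al ^+ 2 + p) * ((al * s + be) ^+ 2 + p * s ^+ 2 - q) = 0.
    transitivity (((al ^+ 2 + p) * s + al * be) ^+ 2 - dlt); first by rewrite /dlt; ring.
    by rewrite e addrAC addNr add0r sqr_sqrtr // subrr.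
  by apply/eqP; rewrite -subr_eq0; move/eqP: h; rewrite mulf_eq0 (negPf ap0).
pose z i : R := s * (i == k)%:R + 1 * (i == m)%:R.
pose vj := - (al * s + be).
pose v i := (x0 j)^-1 * z i + vj / x0 j * x0 i.
have vjE : v j = vj by rewrite /v /z jk jm !mulr0 addr0 mulr0 add0r divfK.
have zE i : z i = x0 j * v i + - v j * x0 i.
  by rewrite vjE /v; field.
have mz (w y : 'I_n -> R) : mom w z y = s * (w k * y k) + w m * y m.
  by rewrite mom_comb !mom_delta mul1r.
have mzz w : mom w z z = s ^+ 2 * w k + w m.
  by rewrite mz /z !eqxx (negPf km) eq_sym (negPf km) /=; ring.
have tv : mom (fun i => (a i)^-1) x0 v = 0.
  rewrite momC mom_comb mz x0_on /vj /al /be; field.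
  by rewrite y0 !gt_eqF.
have Fv : F0 v = 0.
  have : v j ^+ 2 + mom (gap a j) z z = 0.
    by rewrite mzz vjE -/p sqrrN -[gap a j m]opprK -/q -quad; ring.
  have -> : mom (gap a j) z z = mom (gap a j) (fun i => x0 j * v i + - v j * x0 i)
      (fun i => x0 j * v i + - v j * x0 i).
    by congr mom; apply/funext => i; exact: zE.
  rewrite mom_sqr => <-.
  by rewrite /F0 (momC _ v x0); ring.
have nv : 0 < mom (fun=> 1) v v.
  rewrite lt_neqAle mom_ge0 // andbT eq_sym; apply/eqP => n0.
  have v0 i : v i = 0.
    by apply/eqP; rewrite -sqrf_eq0 eq_le sqr_ge0 -n0 sqr_le_mom1.
  have := zE m; rewrite !v0 mulr0 oppr0 mul0r addr0 /z eqxx eq_sym (negPf km).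
  by rewrite mulr0 add0r mulr1 => /eqP; rewrite oner_eq0.
pose c := T / Num.sqrt (mom (fun=> 1) v v).
(* The zero summand gives [v'] the shape of a combination, as [mom_comb] and [mom_sqr] require. *)
pose v' i := c * v i + 0 * x0 i.
have sc1 g : mom g x0 v' = c * mom g x0 v.
  by rewrite momC mom_comb mul0r addr0 momC.
have sc2 g : mom g v' v' = c ^+ 2 * mom g v v by rewrite mom_sqr; ring.
exists v'; split.
- by rewrite sc1 tv mulr0.
- rewrite sc2 expr_div_n sqr_sqrtr ?(ltW nv) //.
  by rewrite divfK ?gt_eqF.
- rewrite -[RHS](mulr0 (c ^+ 2)) -Fv /F0 sc1 sc2 /v'.
  by ring.
Qed.

Lemma null_u0_bound : exists B, forall v, null v -> `|u0 v| <= B.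
Proof.
have [c [C [c0 C0 hc hC]]] := axes_bounds j.
set G := \sum_i `|gap a j i|.
exists (`|(1 + mom (gap a j) x0 x0) / x0 j| * T + G * (T + (1 + C)) ^+ 2).
move=> v [_ nv _].
have vT i : `|v i| <= T.
  by apply: le_norm_of_sqr; rewrite ?(ltW T_gt0) // -nv sqr_le_mom1.
rewrite /u0 (le_trans (ler_normB _ _)) // lerD //.
  by rewrite mulrAC normrM ler_wpM2l.
apply: mom_bound => i.
  rewrite (le_trans (_ : _ <= 1 + C)) ?lerDr ?(ltW T_gt0) //.
  apply: le_norm_of_sqr; first by rewrite addr_ge0 // ltW.
  by rewrite (le_trans (sqr_le_axis i)) // (le_trans (hC i)) //; nra.
by rewrite (le_trans (vT i)) // lerDl addr_ge0 // ltW.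
Qed.

(** The new vector is the velocity on return: it is null again because tangency, speed and [jF] are
    preserved and the base point is the same. This is what allows iteration. *)
Lemma null_step : x0 j != 0 -> returning x0 T ->
  exists2 d, 0 < d & forall v, null v -> exists2 v', null v' & u0 v' <= u0 v - d.
Proof.
move=> y0 ret; have [c [C [c0 C0 hc hC]]] := axes_bounds j.
have E0 : 0 < T ^+ 2 by rewrite exprn_gt0.
pose L := T ^+ 2 * c / C; pose U := T ^+ 2 * C / c.
have L0 : 0 < L by rewrite divr_gt0 // mulr_gt0.
have ny0 : 0 < `|x0 j| by rewrite normr_gt0.
(* At speed [T], the [j]th coordinate keeps at least half of its initial size up to time [e]; there
   [ju] decreases at rate at least [r]. After [e], monotonicity suffices. *)
pose e := Num.min 1 (`|x0 j| / (2 * T)).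
have e0 : 0 < e by rewrite lt_min ltr01 divr_gt0 // mulr_gt0.
have e1 : e <= 1 by rewrite ge_min lexx.
have eT : e * T <= `|x0 j| / 2.
  rewrite -ler_pdivlMr // -mulrA -invfM ge_min; apply/orP; right.
  by [].
pose r := L / a j ^+ 2 * (x0 j ^+ 2 / 4).
have aj2 : 0 < a j ^+ 2 by rewrite exprn_gt0.
have x2 : 0 < x0 j ^+ 2 by rewrite exprn_even_gt0.
have r0 : 0 < r.
  by rewrite mulr_gt0 // divr_gt0.
exists (r * e); first exact: mulr_gt0.
move=> v [tv nv Fv]; have [X [V [l [XV X0 V0 X1]]]] := ret v tv nv.
have lb t : L <= l t <= U.
  by have := flow_mult_bounds a_gt0 XV t c0 hc hC; rewrite V0 nv.
have [dX dV _] := XV.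
have x0E i : X i 0 = x0 i by rewrite -X0.
(* If [X j] and [V j] vanished together, the oscillator estimate would carry the zero back to time
   [0], against [y0]. *)
have rpos t : X j t ^+ 2 + V j t ^+ 2 != 0.
  apply/eqP => rt.
  have := oscillator_gronwall (m := fun t => l t / a j) (K := U / a j) (dX j)
    (fun t => is_derive_eqf (dV j t) _) _ 0 t.
  rewrite rt mul0r x0E => H.
  have : x0 j ^+ 2 + V j 0 ^+ 2 <= 0.
    apply: H => // s; have /andP[l1 l2] := lb s.
    by rewrite ler_pM2r ?invr_gt0 // l2 divr_ge0 // ltW // (lt_le_trans L0).
  by rewrite leNgt ltr_wpDr ?sqr_ge0.
have F t : jF a j X V t = 0.
  rewrite (derivative0_const (djF a_gt0 a_inj j XV) t 0).
  by rewrite /jF /jP /jQ /jS X0 V0 x0E -[RHS]Fv /F0 -V0 /=; ring.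
have uE t : X j t != 0 -> ju a j X V t = jw a j X V t / X j t.
  by move=> yt; rewrite -(ju_w (rpos t) (F t)).1 mulfK.
have du t := dju a_gt0 a_inj XV (rpos t) (F t).
have u0E : ju a j X V 0 = u0 v.
  rewrite uE ?x0E // /jw /jP /jQ X0 V0 x0E /u0 -V0.
  by field.
have u1E : ju a j X V 1 = u0 (V ^~ 1).
  have x1E : X j 1 = x0 j by rewrite -X1.
  rewrite uE ?x1E // /jw /jP /jQ X1 x1E /u0.
  by field.
exists (V ^~ 1).
  split; first by rewrite -X1 (flow_tangent XV).
    by rewrite (flow_speed XV 1 0) V0.
  by rewrite -[RHS](F 1) /F0 /jF /jP /jQ /jS X1 -X1; ring.
have h1 : ju a j X V e - ju a j X V 0 <= - r * (e - 0).
  apply: (mvt_ge du (ltW e0)) => t /andP[t0 te].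
  have /andP[l1 l2] := lb t.
  have yt : `|X j t - x0 j| <= T * (t - 0).
    rewrite -x0E; apply: (mvt_norm (dX j) t0) => s _.
    apply: le_norm_of_sqr; rewrite ?(ltW T_gt0) // -nv -V0.
    exact: flow_v_bound XV _ _.
  have yt2 : `|x0 j| / 2 <= `|X j t|.
    have : T * (t - 0) <= `|x0 j| / 2.
      by rewrite subr0 (le_trans _ eT) // mulrC ler_pM2r.
    have := ler_normB (X j t) (X j t - x0 j).
    rewrite subKr; lra.
  rewrite mulNr lerN2; apply: ler_pM.
  - by rewrite divr_ge0 ?sqr_ge0 // ltW.
  - by rewrite divr_ge0 ?sqr_ge0.
  - by rewrite ler_pM2r ?invr_gt0.
  - rewrite -[x0 j ^+ 2]real_normK ?num_real // -[X j t ^+ 2]real_normK ?num_real //.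
    by nra.
have h2 : ju a j X V 1 - ju a j X V e <= 0 * (1 - e).
  apply: (mvt_ge du e1) => t _.
  have /andP[l1 l2] := lb t.
  by rewrite mulNr oppr_le0 mulr_ge0 ?sqr_ge0 // divr_ge0 ?sqr_ge0 // (le_trans (ltW L0)).
rewrite -u0E -u1E; lra.
Qed.

Lemma returning_middle k m : a k < a j -> a j < a m -> returning x0 T ->
  x0 j = 0.
Proof.
move=> akj ajm ret; apply/eqP/negPn/negP => y0.
have [v nv] := exists_null akj ajm y0.
have [B uB] := null_u0_bound.
have [d d0 step] := null_step y0 ret.
have desc N : exists2 w, null w & u0 w <= u0 v - d * N%:R.
  elim: N => [|N [w nw hw]]; first by exists v => //; rewrite mulr0 subr0.
  have [w' nw' hw'] := step w nw; exists w' => //.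
  by rewrite -natr1; lra.
(* After [N.+1] returns the total decrease exceeds [2 * B], the largest possible variation of
   [u0]. *)
pose N := Num.truncn (2 * B / d).
have [w nw hw] := desc N.+1.
have : 2 * B < d * N.+1%:R.
  by rewrite [ltRHS]mulrC -ltr_pdivrMr // truncnS_gt.
have := uB _ nv; have := uB _ nw; rewrite !ler_norml => /andP[h1 h2] /andP[h3 h4].
lra.
Qed.

End Returning.

(** * Points in the plane of the extreme axes *)

Section Bounded.
Variables (R : realType) (J : Type) (D : J -> Prop).
Implicit Types f g : J -> R.

Definition bdd f := exists M, forall s, D s -> `|f s| <= M.

Lemma bdd_cst c : bdd (fun=> c).
Proof. by exists `|c|. Qed.

Lemma bddD f g : bdd f -> bdd g -> bdd (fun s => f s + g s).
Proof.
move=> [M hM] [N hN]; exists (M + N) => s Ds.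
by rewrite (le_trans (ler_normD _ _)) // lerD ?hM ?hN.
Qed.

Lemma bddN f : bdd f -> bdd (fun s => - f s).
Proof. by move=> [M hM]; exists M => s Ds; rewrite normrN hM. Qed.

Lemma bddM f g : bdd f -> bdd g -> bdd (fun s => f s * g s).
Proof.
move=> [M hM] [N hN]; exists (M * N) => s Ds.
by rewrite normrM ler_pM ?hM ?hN.
Qed.

Lemma bddX f k : bdd f -> bdd (fun s => f s ^+ k).
Proof.
move=> [M hM]; exists (M ^+ k) => s Ds.
by rewrite normrX lerXn2r ?nnegrE ?hM // (le_trans _ (hM s Ds)).
Qed.

Lemma bdd_sqrt f : bdd f -> bdd (fun s => Num.sqrt (f s)).
Proof.
move=> [M hM]; exists (1 + M) => s Ds.
have M0 : 0 <= M by exact: le_trans (hM s Ds).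
apply: le_norm_of_sqr; first by rewrite addr_ge0.
have [f0|f0] := leP 0 (f s).
  by rewrite sqr_sqrtr //; have := hM s Ds; rewrite ger0_norm //; nra.
by rewrite ltr0_sqrtr // expr0n sqr_ge0.
Qed.

Lemma bdd_mom n (m : 'I_n -> R) (x y : J -> 'I_n -> R) :
  (exists B, forall s i, D s -> `|x s i| <= B /\ `|y s i| <= B) ->
  bdd (fun s => mom m (x s) (y s)).
Proof.
move=> [B hB]; exists ((\sum_i `|m i|) * B ^+ 2) => s Ds.
by apply: mom_bound => i; have [] := hB s i Ds.
Qed.

Lemma bdd_pos f : bdd f -> exists2 M, 0 < M & forall s, D s -> `|f s| <= M.
Proof.
move=> [M hM]; exists (1 + `|M|) => [|s Ds]; first by rewrite ltr_wpDr.
by rewrite (le_trans (hM s Ds)) // (le_trans (ler_norm M)) // lerDr.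
Qed.

End Bounded.

Ltac bound := repeat first
  [ assumption
  | notypeclasses refine (bddD _ _) | notypeclasses refine (bddN _)
  | notypeclasses refine (bddX _ _) | notypeclasses refine (bddM _ _)
  | notypeclasses refine (bdd_cst _ _) ].

Lemma mom_supp2 (R : realType) n (m x y : 'I_n -> R) p q : p != q ->
  (forall i, i != p -> i != q -> x i * y i = 0) ->
  mom m x y = m p * x p * y p + m q * x q * y q.
Proof.
move=> pq h; rewrite /mom (bigD1 p) //= (bigD1 q) 1?eq_sym //= big1 ?addr0 //.
by move=> i /andP[ip iq]; rewrite -mulrA h ?mulr0.
Qed.

Lemma mom_supp3 (R : realType) n (m x y : 'I_n -> R) p q r : p != q -> p != r -> q != r ->
  (forall i, i != p -> i != q -> i != r -> x i * y i = 0) ->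
  mom m x y = m p * x p * y p + m q * x q * y q + m r * x r * y r.
Proof.
move=> pq pr qr h; rewrite /mom (bigD1 p) //= (bigD1 q) 1?eq_sym //=.
rewrite (bigD1 r) /=; last by rewrite ![r == _]eq_sym pr qr.
rewrite big1 ?addr0 ?addrA //.
by move=> i /andP[/andP[ip iq] ir]; rewrite -mulrA h ?mulr0.
Qed.

Section ExtremePlane.
Variables (R : realType) (n : nat) (a : 'I_n -> R).
Hypothesis a_gt0 : forall i, 0 < a i.
Hypothesis a_inj : injective a.
Variables (x0 : 'I_n -> R) (T : R) (p q j : 'I_n).
Hypothesis T_gt0 : 0 < T.
Hypothesis x0_on : mom (fun i => (a i)^-1) x0 x0 = 1.
Hypothesis x0_supp : forall i, i != p -> i != q -> x0 i = 0.
Hypothesis apj : a p < a j.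
Hypothesis ajq : a j < a q.

Let pq : p != q.
Proof. by apply/eqP => e; move: ajq; rewrite -e ltNge ltW. Qed.
Let pj : p != j.
Proof. by apply/eqP => e; move: apj; rewrite e ltxx. Qed.
Let qj : q != j.
Proof. by apply/eqP => e; move: ajq; rewrite e ltxx. Qed.
Let x0j : x0 j = 0.
Proof. by apply: x0_supp; rewrite eq_sym. Qed.
Let ap0 := a_gt0 p.
Let aq0 := a_gt0 q.
Let aj0 := a_gt0 j.

Lemma extreme_on : x0 p ^+ 2 / a p + x0 q ^+ 2 / a q = 1.
Proof.
rewrite -x0_on (mom_supp2 _ pq) => [|i ip iq]; first by ring.
by rewrite x0_supp ?mul0r.
Qed.

Lemma extreme_tangent : exists tau : 'I_n -> R,
  [/\ forall i, i != p -> i != q -> tau i = 0,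
      mom (fun i => (a i)^-1) x0 tau = 0 & mom (fun=> 1) tau tau = 1].
Proof.
(* The normal of the ellipse in the plane of the axes [p] and [q], turned by a right angle. *)
pose t i : R := if i == p then x0 q / a q else if i == q then - x0 p / a p else 0.
have tp : t p = x0 q / a q by rewrite /t eqxx.
have tq : t q = - x0 p / a p by rewrite /t eqxx eq_sym (negPf pq).
have t0 i : i != p -> i != q -> t i = 0 by rewrite /t => /negPf-> /negPf->.
pose N := (x0 q / a q) ^+ 2 + (x0 p / a p) ^+ 2.
have N0 : 0 < N.
  rewrite lt_neqAle addr_ge0 ?sqr_ge0 // andbT eq_sym; apply/eqP => h.
  have /andP[/eqP xq /eqP xp] : (x0 q / a q == 0) && (x0 p / a p == 0).
    by move/eqP: h; rewrite paddr_eq0 ?sqr_ge0 // !sqrf_eq0.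
  have := extreme_on; rewrite !expr2 -!mulrA xq xp !mulr0 addr0 => /eqP.
  by rewrite eq_sym oner_eq0.
exists (fun i => t i / Num.sqrt N); split.
- by move=> i ip iq; rewrite t0 ?mul0r.
- rewrite (mom_supp2 _ pq) => [|i ip iq]; last by rewrite x0_supp ?mul0r.
  by rewrite tp tq; ring.
- rewrite (mom_supp2 _ pq) => [|i ip iq]; last by rewrite t0 ?mul0r.
  rewrite tp tq; transitivity (N / Num.sqrt N ^+ 2); first by rewrite -exprVn /N; ring.
  by rewrite sqr_sqrtr ?(ltW N0) // divff // gt_eqF.
Qed.

Variable tau : 'I_n -> R.
Hypothesis tau_supp : forall i, i != p -> i != q -> tau i = 0.
Hypothesis tau_tangent : mom (fun i => (a i)^-1) x0 tau = 0.
Hypothesis tau_unit : mom (fun=> 1) tau tau = 1.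

Let tauj : tau j = 0.
Proof. by apply: tau_supp; rewrite eq_sym. Qed.

(** The expression equals [- a j * gp * gq], and [gp] and [gq] have opposite signs because [a j]
    lies strictly between [a p] and [a q]. *)
Lemma extreme_disc : 0 < mom (gap a j) x0 tau ^+ 2
  - (1 + mom (gap a j) x0 x0) * mom (gap a j) tau tau.
Proof.
have hx := extreme_on.
have ht : x0 p * tau p / a p + x0 q * tau q / a q = 0.
  rewrite -tau_tangent (mom_supp2 _ pq) => [|i ip iq].
    by ring.
  by rewrite x0_supp ?mul0r.
have hu : tau p ^+ 2 + tau q ^+ 2 = 1.
  rewrite -tau_unit (mom_supp2 _ pq) => [|i ip iq].
    by ring.
  by rewrite tau_supp ?mul0r.
(* Lagrange's identity for the inner product with weights [1 / a i]. *)
have hA : (x0 p * tau q - x0 q * tau p) ^+ 2 = a q * tau p ^+ 2 + a p * tau q ^+ 2.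
  have e : (x0 p * tau q - x0 q * tau p) ^+ 2 = a p * a q *
     ((x0 p ^+ 2 / a p + x0 q ^+ 2 / a q) * (tau p ^+ 2 / a p + tau q ^+ 2 / a q)
      - (x0 p * tau p / a p + x0 q * tau q / a q) ^+ 2).
    by field; rewrite !gt_eqF.
  by rewrite e hx ht; field; rewrite !gt_eqF.
rewrite !(mom_supp2 _ pq); first last.
- by move=> i ip iq; rewrite x0_supp ?mul0r.
- by move=> i ip iq; rewrite x0_supp ?mul0r.
- by move=> i ip iq; rewrite tau_supp ?mul0r.
set gp := gap a j p; set gq := gap a j q.
have -> : (gp * x0 p * tau p + gq * x0 q * tau q) ^+ 2 -
  (1 + (gp * x0 p * x0 p + gq * x0 q * x0 q)) *
  (gp * tau p * tau p + gq * tau q * tau q) =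
  - gp * tau p ^+ 2 - gq * tau q ^+ 2
   - gp * gq * (x0 p * tau q - x0 q * tau p) ^+ 2 by ring.
rewrite hA (_ : _ - _ = - a j * gp * gq * (tau p ^+ 2 + tau q ^+ 2)); last first.
  by rewrite /gp /gq /gap; field; rewrite !subr_eq0 (gt_eqF apj) (lt_eqF ajq).
rewrite hu mulr1 !mulNr -mulrN mulr_gt0 ?mulr_gt0 //.
  by rewrite invr_gt0 subr_gt0.
by rewrite -invrN opprB invr_gt0 subr_gt0.
Qed.

(** The direction [tau] of the ellipse tilted towards the axis [j], with total length [T]; tangent
    to the ellipsoid since [x0 j = 0]. *)
Definition vstart e i : R := T * Num.sqrt (1 - e ^+ 2) * tau i + T * e * (i == j)%:R.

(** * Geodesics launched close to the extreme ellipse *)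

Section Motion.
Variables (e : R) (X V : 'I_n -> R -> R) (l : R -> R).

Definition launched := [/\ flow a X V l, X ^~ 0 = x0, V ^~ 0 = vstart e & X ^~ 1 = x0].

Hypothesis e_gt0 : 0 < e.
Hypothesis e_le : e <= 2^-1.

Lemma sqrt_start : Num.sqrt (1 - e ^+ 2) ^+ 2 = 1 - e ^+ 2.
Proof.
rewrite sqr_sqrtr // subr_ge0 exprn_ile1 ?(ltW e_gt0) //.
by rewrite (le_trans e_le) //; lra.
Qed.

Lemma vstart_tangent : mom (fun i => (a i)^-1) x0 (vstart e) = 0.
Proof.
rewrite momC mom_comb momC tau_tangent mulr0 add0r mom_delta x0j.
by rewrite !mulr0.
Qed.

Lemma vstart_speed : mom (fun=> 1) (vstart e) (vstart e) = T ^+ 2.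
Proof.
rewrite mom_sqr tau_unit (momC _ tau) !mom_delta tauj eqxx exprMn sqrt_start /=.
by ring.
Qed.

Lemma vstart_j : vstart e j = T * e.
Proof. by rewrite /vstart tauj eqxx mulr0 add0r mulr1. Qed.

Hypothesis XV : launched.

Lemma launched_speed : mom (fun=> 1) (V ^~ 0) (V ^~ 0) = T ^+ 2.
Proof. by case: XV => _ _ -> _; exact: vstart_speed. Qed.

Lemma launched_bounds (c C t : R) : 0 < c -> (forall i, c <= a i) ->
  (forall i, a i <= C) -> T ^+ 2 * c / C <= l t <= T ^+ 2 * C / c.
Proof.
move=> c0 hc hC; case: (XV) => hf _ _ _; rewrite -launched_speed.
exact: (flow_mult_bounds a_gt0 hf).
Qed.

Lemma launched_gronwall U i s t : (forall t, 0 <= l t <= U) ->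
  X i s ^+ 2 + V i s ^+ 2 <=
  (X i t ^+ 2 + V i t ^+ 2) * expR ((1 + U / a i) * `|s - t|).
Proof.
move=> hU; case: XV => [[dX dV _] _ _ _].
apply: (oscillator_gronwall (m := fun t => l t / a i) (dX i) (dV i)) => r.
have /andP[l0 lU] := hU r.
by rewrite ler_pM2r ?invr_gt0 // lU andbT divr_ge0 // ltW.
Qed.

(** Such a coordinate is an oscillator starting at zero with zero velocity, so the motion involves
    the axes [p], [q], [j] only. *)
Lemma launched_zero i t : i != p -> i != q -> i != j -> X i t = 0 /\ V i t = 0.
Proof.
move=> ip iq ij; have [c [C [c0 C0 hc hC]]] := axes_bounds a_gt0 j.
have hU s : 0 <= l s <= T ^+ 2 * C / c.
  have /andP[l1 ->] := launched_bounds s c0 hc hC.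
  by rewrite (le_trans _ l1) // divr_ge0 ?mulr_ge0 ?sqr_ge0 // ltW.
have := launched_gronwall i t 0 hU; case: XV => _ hX hV _.
have -> : X i 0 = 0 by rewrite -[RHS](x0_supp ip iq) -hX.
have -> : V i 0 = vstart e i by rewrite -hV.
rewrite /vstart tau_supp // (negPf ij) !mulr0 addr0 expr0n /= addr0 mul0r => h.
have := addr_ge0 (sqr_ge0 (X i t)) (sqr_ge0 (V i t)); rewrite le0r ltNge h orbF.
by rewrite paddr_eq0 ?sqr_ge0 // !sqrf_eq0 => /andP[/eqP -> /eqP ->].
Qed.

Lemma launched_relations t :
  [/\ X p t ^+ 2 / a p + X q t ^+ 2 / a q = 1 - X j t ^+ 2 / a j,
      X p t * V p t / a p + X q t * V q t / a q = - (X j t * V j t / a j)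
    & V p t ^+ 2 + V q t ^+ 2 = T ^+ 2 - V j t ^+ 2].
Proof.
have [hf _ _ _] := XV; have [_ _ hon] := hf; have z := @launched_zero _ t.
split.
- rewrite -(hon t) (mom_supp3 _ pq pj qj) => [|i ip iq ij]; first by ring.
  by rewrite (z i ip iq ij).1 mul0r.
- have := flow_tangent hf t; rewrite (mom_supp3 _ pq pj qj) => [h|i ip iq ij].
    by apply/eqP; rewrite -subr_eq0 -[0]h; apply/eqP; ring.
  by rewrite (z i ip iq ij).1 mul0r.
- rewrite -launched_speed (flow_speed hf 0 t).
  rewrite (mom_supp3 _ pq pj qj) => [|i ip iq ij]; first by ring.
  by rewrite (z i ip iq ij).2 mul0r.
Qed.

(* The [p, q] part of the motion cannot turn back as long as [area] has no zero. *)
Definition area t := X p t * V q t - X q t * V p t.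

Lemma area_sqr t : area t ^+ 2 = a p * a q *
  ((1 - X j t ^+ 2 / a j) * (V p t ^+ 2 / a p + V q t ^+ 2 / a q)
   - (X j t * V j t / a j) ^+ 2).
Proof.
have [<- h _] := launched_relations t.
rewrite -[(X j t * V j t / a j) ^+ 2]sqrrN -h /area.
by field; rewrite !gt_eqF.
Qed.

(** In [area_sqr] the two factors are at least [1 / 2] and [3 / 4 * s], while the subtracted square
    is at most [g ^ 2 / 4], with [g <= 1 / 2] and [4 * g <= s]. *)
Lemma area_neq0 C h t : (forall i, a i <= C) -> X j t ^+ 2 + V j t ^+ 2 <= h ->
  h <= a j / 2 -> h <= a j * T ^+ 2 / (4 * C) -> area t != 0.
Proof.
move=> hC hh h1 h2; rewrite -sqrf_eq0 area_sqr; apply: lt0r_neq0.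
rewrite mulr_gt0 ?mulr_gt0 // subr_gt0.
have C0 : 0 < C by exact: lt_le_trans (hC j).
have [_ _ hs] := launched_relations t.
set y := X j t in hh *; set v := V j t in hh hs *.
have y0 := sqr_ge0 y; have v0 := sqr_ge0 v.
have h0 : 0 <= h by lra.
pose s := T ^+ 2 / C; have s0 : 0 < s by rewrite divr_gt0 ?exprn_gt0.
pose g := h / a j.
have g0 : 0 <= g by rewrite divr_ge0 // ltW.
have g1 : g <= 2^-1 by rewrite ler_pdivrMr // mulrC.
have g2 : 4 * g <= s.
  rewrite /g mulrA ler_pdivrMr // -ler_pdivlMl //.
  rewrite (le_trans h2) // le_eqVlt; apply/orP; left; apply/eqP.
  by rewrite /s; field; rewrite gt_eqF.
have yg : y ^+ 2 / a j <= g by rewrite /g ler_pM2r ?invr_gt0 //; lra.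
have vs : v ^+ 2 / C <= s / 4.
  have : v ^+ 2 <= T ^+ 2 / 4.
    have : h <= T ^+ 2 / 4.
      apply: le_trans h2 _; rewrite ler_pdivrMr ?mulr_gt0 //.
      rewrite (_ : _ / 4 * _ = T ^+ 2 * C); last by field.
      by rewrite mulrC ler_wpM2l ?sqr_ge0.
    lra.
  by rewrite (_ : s / 4 = T ^+ 2 / 4 / C) ?ler_pM2r ?invr_gt0 // /s; field; rewrite gt_eqF.
have W : 3 / 4 * s <= V p t ^+ 2 / a p + V q t ^+ 2 / a q.
  have -> : 3 / 4 * s = s - s / 4 by field.
  apply: (@le_trans _ _ (V p t ^+ 2 / C + V q t ^+ 2 / C)).
    by rewrite -mulrDl hs mulrBl -/s; lra.
  by rewrite lerD // ler_wpM2l ?sqr_ge0 // lef_pV2 ?posrE.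
have yv : (y * v / a j) ^+ 2 <= g ^+ 2 / 4.
  have -> : g ^+ 2 / 4 = (g / 2) ^+ 2 by field.
  have k : `|y * v / a j| <= g / 2.
    rewrite normrM [`|(a j)^-1|]ger0_norm ?invr_ge0 ?(ltW aj0) // /g mulrAC.
    rewrite ler_pM2r ?invr_gt0 // ler_norml; apply/andP; split.
      by have := sqr_ge0 (y + v); nra.
    by have := sqr_ge0 (y - v); nra.
  by rewrite -[leLHS]real_normK ?num_real // ler_sqr ?nnegrE // divr_ge0.
have yg0 : 0 <= y ^+ 2 / a j by rewrite divr_ge0 // ltW.
apply: (le_lt_trans yv); move: W.
move: (V p t ^+ 2 / a p + V q t ^+ 2 / a q) => w W.
apply: (@lt_le_trans _ _ (2^-1 * (3 / 4 * s))); first by nra.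
by rewrite ler_pM //; [nra | lra].
Qed.

Hypothesis P0_neq0 : 1 + mom (gap a j) x0 x0 != 0.

(** Where [X j] vanishes, the conserved [jF] reduces to [jP * V j ^ 2], and [jP] is the same nonzero
    number at both ends. *)
Lemma launched_j_sqr : V j 1 ^+ 2 = V j 0 ^+ 2.
Proof.
have [hf X0 _ X1] := XV.
have := derivative0_const (djF a_gt0 a_inj j hf) 1 0.
rewrite /jF /jP X0 X1.
have -> : X j 0 = 0 by rewrite -[RHS]x0j -X0.
have -> : X j 1 = 0 by rewrite -[RHS]x0j -X1.
rewrite !mulr0 !mul0r !expr0n /= !mulr0 !subr0 !addr0.
exact: mulfI.
Qed.

(** Conservation of speed and [launched_j_sqr] determine [area 1] up to sign; the sign is that of
    [area 0], as [area] has no zero in between. Only [V j] may come back reversed. *)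
Lemma launched_return C h : (forall i, a i <= C) ->
  (forall t, 0 <= t <= 1 -> X j t ^+ 2 + V j t ^+ 2 <= h) ->
  h <= a j / 2 -> h <= a j * T ^+ 2 / (4 * C) ->
  forall i, i != j -> V i 1 = V i 0.
Proof.
move=> hC hh h1 h2.
have [[dX dV _] X0 _ X1] := XV.
have x0E i : X i 0 = x0 i by rewrite -X0.
have x1E i : X i 1 = x0 i by rewrite -X1.
have A0 t : 0 <= t <= 1 -> area t != 0.
  by move=> t01; apply: area_neq0 hC (hh t t01) h1 h2.
have dXp := dX p; have dXq := dX q; have dVp := dV p; have dVq := dV q.
have dA (t : R) : is_derive t 1 area (l t * (1 / a p - 1 / a q) * X p t * X q t).
  by rewrite /area; deriv; field; rewrite !gt_eqF.
have Apos : 0 < area 0 * area 1.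
  rewrite ltNge; apply/negP => Aneg.
  have cA : {within `[0, 1], continuous area}.
    by apply: continuous_subspaceT; exact: (derivE_continuous dA).
  have [|t t01 At] := IVT ler01 cA (v := 0).
    have n0 : area 0 != 0 by apply: A0; rewrite lexx ler01.
    have n1 : area 1 != 0 by apply: A0; rewrite lexx ler01.
    rewrite ge_min le_max; case: (leP (area 0) 0) => a0; case: (leP (area 1) 0) => a1 /=.
    - by move: Aneg; rewrite leNgt nmulr_rgt0 lt_neqAle ?n0 ?n1 ?a0 ?a1.
    - by rewrite (ltW a1) orbT.
    - by rewrite (ltW a0).
    - by move: Aneg; rewrite leNgt mulr_gt0.
  move: t01; rewrite in_itv /= => t01.
  by have := A0 t t01; rewrite At eqxx.
have on := extreme_on.
(* At [x0] tangency leaves, for the [p] and [q] entries of the velocity, only the multiples of the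
   turned normal; the factor is [area t]. *)
have sol t : (forall i, X i t = x0 i) ->
    V q t = x0 p / a p * area t /\ V p t = - (x0 q / a q) * area t.
  move=> xt; have [_ ht _] := launched_relations t.
  have /eqP ht' : x0 p * V p t / a p + x0 q * V q t / a q == 0.
    by rewrite -!xt ht !xt x0j !mul0r oppr0.
  rewrite /area !xt; split.
    rewrite -[LHS]mul1r -on; apply/eqP; rewrite -subr_eq0.
    by apply/eqP; rewrite -[RHS](mulr0 (x0 q)) -ht'; ring.
  rewrite -[LHS]mul1r -on; apply/eqP; rewrite -subr_eq0.
  by apply/eqP; rewrite -[RHS](mulr0 (x0 p)) -ht'; ring.
have [q0 p0] := sol 0 x0E; have [q1 p1] := sol 1 x1E.
have nz : (x0 p / a p) ^+ 2 + (x0 q / a q) ^+ 2 != 0.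
  apply/eqP => h0.
  have /andP[/eqP xp /eqP xq] : (x0 p / a p == 0) && (x0 q / a q == 0).
    by move/eqP: h0; rewrite paddr_eq0 ?sqr_ge0 // !sqrf_eq0.
  by have /eqP := on; rewrite !expr2 -!mulrA xq xp !mulr0 addr0 eq_sym oner_eq0.
have Asq : area 1 ^+ 2 = area 0 ^+ 2.
  apply: (mulfI nz).
  have [_ _ e0] := launched_relations 0; have [_ _ e1] := launched_relations 1.
  transitivity (T ^+ 2 - V j 1 ^+ 2); first by rewrite -e1 q1 p1; ring.
  by rewrite launched_j_sqr -e0 q0 p0; ring.
have A10 : area 1 = area 0.
  move/eqP: Asq; rewrite eqf_sqr => /orP[/eqP //|/eqP A1].
  by move: Apos; rewrite A1 mulrN -expr2 oppr_gt0 ltNge sqr_ge0.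
move=> i ij; have [->|ip] := eqVneq i p; first by rewrite p1 p0 A10.
have [->|iq] := eqVneq i q; first by rewrite q1 q0 A10.
by rewrite !(launched_zero _ ip iq ij).2.
Qed.

End Motion.

(* Bounds uniform in the geodesic, the time and the size [sE] of the initial
   deviation from the plane are boundedness statements over this type. *)
Record snapshot := Snapshot
  { sE : R; sX : 'I_n -> R -> R; sV : 'I_n -> R -> R; sl : R -> R; st : R }.

Definition admissible s := [/\ 0 < sE s, sE s <= 2^-1, 0 <= st s <= 1
  & launched (sE s) (sX s) (sV s) (sl s)].

Definition start s := Snapshot (sE s) (sX s) (sV s) (sl s) 0.

Lemma admissible_start s : admissible s -> admissible (start s).
Proof. by case=> h1 h2 h3 h4; split => //=; rewrite lexx ler01. Qed.

Lemma bdd_start (f : snapshot -> R) :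
  bdd admissible f -> bdd admissible (fun s => f (start s)).
Proof. by move=> [M hM]; exists M => s /admissible_start /hM. Qed.

Definition growth U := T ^+ 2 * expR (1 + U / a j).

Lemma launched_small U e X V l t : 0 < e -> e <= 2^-1 -> launched e X V l ->
  (forall t, 0 <= l t <= U) -> 0 <= t <= 1 ->
  X j t ^+ 2 + V j t ^+ 2 <= e ^+ 2 * growth U.
Proof.
move=> e0 e1 XV hU /andP[t0 t1].
have := launched_gronwall XV j t 0 hU; case: XV => _ hX hV _.
have -> : X j 0 = 0 by rewrite -[RHS]x0j -hX.
have -> : V j 0 = T * e by rewrite -(vstart_j e) -hV.
move=> h; apply: (le_trans h).
have U0 : 0 <= U by have /andP[l0] := hU 0; exact: le_trans.
rewrite expr0n add0r exprMn /growth.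
rewrite (_ : e ^+ 2 * _ = T ^+ 2 * e ^+ 2 * expR (1 + U / a j)); last by ring.
rewrite ler_wpM2l //; first by rewrite mulr_ge0 ?sqr_ge0.
rewrite ler_expR subr0 ger0_norm // -[leRHS]mulr1 ler_wpM2l //.
by rewrite addr_ge0 // divr_ge0 // ltW.
Qed.

(** The weight at [j] is the junk value [0], so these sums do not see the tilt of [vstart] nor the
    sign of [V j] on return. *)
Lemma gap_ext (x y y' : 'I_n -> R) : (forall i, i != j -> y i = y' i) ->
  mom (gap a j) x y = mom (gap a j) x y' /\
  mom (fun i => gap a j i ^+ 2) x y = mom (fun i => gap a j i ^+ 2) x y'.
Proof.
move=> h; split; apply: eq_bigr => i _; (have [->|ij] := eqVneq i j; last by rewrite h);
  by rewrite /gap subrr invr0 ?expr0n ?mul0r.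
Qed.

Lemma gap_ext2 (y y' : 'I_n -> R) : (forall i, i != j -> y i = y' i) ->
  mom (gap a j) y y = mom (gap a j) y' y' /\
  mom (fun i => gap a j i ^+ 2) y y = mom (fun i => gap a j i ^+ 2) y' y'.
Proof.
move=> h; have [h1 h2] := gap_ext y h; have [h3 h4] := gap_ext y' h.
by rewrite h1 h2 momC h3 (momC _ y y') h4.
Qed.

Lemma disc_start e X V l : 0 < e -> e <= 2^-1 -> launched e X V l ->
  jD a j X V 0 = T ^+ 2 * (1 - e ^+ 2) * (mom (gap a j) x0 tau ^+ 2
    - (1 + mom (gap a j) x0 x0) * mom (gap a j) tau tau).
Proof.
move=> e0 e1 [_ hX hV _]; rewrite /jD /jQ /jP /jS hX hV.
have h i : i != j -> vstart e i = T * Num.sqrt (1 - e ^+ 2) * tau i + 0 * tau i.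
  by move=> /negPf ij; rewrite /vstart ij mulr0 mul0r.
rewrite (gap_ext x0 h).1 (gap_ext2 h).1 mom_sqr (momC _ x0) mom_comb (momC _ tau x0).
by rewrite -[X in T ^+ 2 * X](sqrt_start e0 e1); ring.
Qed.

Definition kap s := Num.sqrt (jD a j (sX s) (sV s) 0).

Lemma kap_sqr s : admissible s -> kap s ^+ 2 = jD a j (sX s) (sV s) 0.
Proof.
move=> [e0 e1 _ h]; rewrite sqr_sqrtr // (disc_start e0 e1 h).
by rewrite mulr_ge0 ?(ltW extreme_disc) // mulr_ge0 ?sqr_ge0 // -(sqrt_start e0 e1) sqr_ge0.
Qed.

(** * Bounds uniform in the size of the tilt *)

Section Estimates.
Variables (U C : R).
Hypothesis aC : forall i, a i <= C.
Hypothesis lU : forall s, admissible s -> forall t, 0 <= sl s t <= U.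

Notation bounded := (bdd admissible).
Notation cX := (fun s => (sX s) ^~ (st s)).
Notation cV := (fun s => (sV s) ^~ (st s)).

Lemma bdd_l : bounded (fun s => sl s (st s)).
Proof.
by exists U => s Ds; have /andP[l0 l1] := lU Ds (st s); rewrite ger0_norm.
Qed.

Lemma XV_bound : exists B, forall s i, admissible s ->
  `|cX s i| <= B /\ `|cV s i| <= B.
Proof.
have C0 : 0 < C by exact: lt_le_trans (aC j).
exists (T + (1 + C)) => s i [e0 e1 _ h]; have [hf _ _ _] := h; split.
  rewrite (le_trans (_ : _ <= 1 + C)) ?lerDr ?(ltW T_gt0) //.
  apply: le_norm_of_sqr; first by rewrite addr_ge0 // ltW.
  by rewrite (le_trans (flow_x_bound a_gt0 hf i _)) // (le_trans (aC i)) //; nra.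
rewrite (le_trans (_ : _ <= T)) ?lerDl ?addr_ge0 // ?(ltW C0) //.
apply: le_norm_of_sqr; first exact: ltW.
by rewrite -(launched_speed e0 e1 h) (flow_v_bound hf).
Qed.

Lemma bdd_momXV m : [/\ bounded (fun s => mom m (cX s) (cX s)),
  bounded (fun s => mom m (cX s) (cV s)) & bounded (fun s => mom m (cV s) (cV s))].
Proof.
have [B hB] := XV_bound.
by split; apply: bdd_mom; exists B => s i /(hB s i) [].
Qed.

(* Below, a prefix [e] marks a quantity divided by the power of [sE] that makes
   it bounded as [sE] tends to [0]. *)
Definition ey s := sX s j (st s) / sE s.
Definition ev s := sV s j (st s) / sE s.

Lemma bdd_ey_ev : bounded ey /\ bounded ev.
Proof.
have G0 : 0 < growth U by rewrite mulr_gt0 ?exprn_gt0 ?expR_gt0.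
have h s : admissible s -> ey s ^+ 2 + ev s ^+ 2 <= growth U.
  move=> Ds; have [e0 e1 t01 XV] := Ds.
  rewrite /ey /ev !expr_div_n -mulrDl ler_pdivrMr ?exprn_gt0 // mulrC.
  exact: launched_small e0 e1 XV (lU Ds) t01.
split; exists (1 + growth U) => s Ds; (apply: le_norm_of_sqr;
  first by rewrite addr_ge0 // ltW); have := h s Ds;
  have := sqr_ge0 (ey s); have := sqr_ge0 (ev s); nra.
Qed.

Notation cP := (fun s => jP a j (sX s) (st s)).
Notation cQ := (fun s => jQ a j (sX s) (sV s) (st s)).
Notation cS := (fun s => jS a j (sV s) (st s)).
Notation cP2 := (fun s => jP2 a j (sX s) (st s)).
Notation cQ2 := (fun s => jQ2 a j (sX s) (sV s) (st s)).
Notation cS2 := (fun s => jS2 a j (sV s) (st s)).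

Lemma bdd_sums : [/\ bounded cP, bounded cQ & bounded cS] /\
  [/\ bounded cP2, bounded cQ2 & bounded cS2].
Proof.
have [h1 h2 h3] := bdd_momXV (gap a j).
have [h4 h5 h6] := bdd_momXV (fun i => gap a j i ^+ 2).
by split; split => //; apply: bddD => //; exact: bdd_cst.
Qed.

Definition ew s := cP s * ev s - cQ s * ey s.
Definition ez s := cQ s * ev s - cS s * ey s.
Definition ep s := ew s + kap s * ey s.
Definition er s := ez s + kap s * ev s.
Definition eN s := ev s ^+ 2 * cP2 s - 2 * ey s * ev s * cQ2 s + ey s ^+ 2 * cS2 s.
(** The remainder in [djN], with [jD - k ^ 2] rewritten through [disc_drift] as a difference of
    values of [eN]. *)
Definition eErr s := 2 * sl s (st s) * (a j ^+ 2)^-1 *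
  (ep s * ((eN (start s) - eN s) * ey s
           - ey s * (a j)^-1 * (ey s * er s - ep s * ev s))
   + ey s ^+ 2 * (er s * ey s * cQ2 s - er s * ev s * cP2 s
           - ep s * ey s * cS2 s + ep s * ev s * cQ2 s)).
Definition edp s := ez s - sl s (st s) * (a j ^+ 2)^-1 * ey s ^+ 3 * sE s ^+ 2
  + kap s * ev s.

Lemma bdd_err : bounded eErr /\ bounded edp.
Proof.
have [[bP bQ bS] [bP2 bQ2 bS2]] := bdd_sums.
have [by_ bv] := bdd_ey_ev; have bl := bdd_l.
have bE : bounded sE.
  exists 1 => s [e0 e1 _ _]; rewrite gtr0_norm // (le_trans e1) //; lra.
have bk : bounded kap.
  apply: bdd_sqrt.
  have : bounded (fun s => cQ s ^+ 2 - cP s * cS s) by bound.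
  by move/bdd_start.
have bw : bounded ew by rewrite /ew; bound.
have bz : bounded ez by rewrite /ez; bound.
have bp : bounded ep by rewrite /ep; bound.
have bq : bounded er by rewrite /er; bound.
have bN : bounded eN by rewrite /eN; bound.
have bN0 := bdd_start bN.
by split; [rewrite /eErr; bound | rewrite /edp; bound].
Qed.

End Estimates.

(** * The monotone quadratic form along a launched geodesic *)

Section Rescaling.
Variables (e : R) (X V : 'I_n -> R -> R) (l : R -> R).
Hypothesis e_gt0 : 0 < e.
Hypothesis e_le : e <= 2^-1.
Hypothesis XV : launched e X V l.

Let sn t := Snapshot e X V l t.
Let k := kap (sn 0).
Let e0 : e != 0. Proof. by rewrite gt_eqF. Qed.
Let kE t : kap (sn t) = k. Proof. by []. Qed.

Lemma rescale_p t : jw a j X V t + k * X j t = e * ep (sn t).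
Proof. by rewrite /ep kE /ew /jw /ey /ev /=; field. Qed.

Lemma rescale_q t : jz a j X V t + k * V j t = e * er (sn t).
Proof. by rewrite /er kE /ez /jz /ey /ev /=; field. Qed.

Lemma disc_drift t : jD a j X V t - k ^+ 2 = e ^+ 2 * (eN (sn 0) - eN (sn t)).
Proof.
have [hf _ _ _] := XV.
have E u : jNf a j X V u (X j u) (V j u) = e ^+ 2 * eN (sn u).
  by rewrite /jNf /eN /ey /ev /=; field.
have ad : admissible (sn 0) by split; rewrite ?lexx ?ler01.
have := derivative0_const (djD a_gt0 a_inj j hf) t 0.
rewrite !E (kap_sqr ad) /= mulrBr; lra.
Qed.

Definition speedN t := 2 * l t / a j ^+ 2 * k * (e * ep (sn t)) ^+ 2
  + e ^+ 4 * eErr (sn t).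

Definition functN t := jNf a j X V t (jw a j X V t + k * X j t)
  (jz a j X V t + k * V j t).

Lemma d_functN (t : R) : is_derive t 1 functN (speedN t).
Proof.
have [hf _ _ _] := XV.
apply: (is_derive_eqf (djN a_gt0 a_inj j hf k t)).
rewrite /speedN rescale_p rescale_q disc_drift /eErr /=.
by rewrite /ey /ev /=; field; rewrite e0 gt_eqF.
Qed.

Lemma d_p (t : R) : is_derive t 1 (fun s => jw a j X V s + k * X j s) (e * edp (sn t)).
Proof.
have [hf _ _ _] := XV; have [dX _ _] := hf; have dXj := dX j.
have dw := djw a_gt0 a_inj j hf; deriv.
rewrite /edp kE /ez /ey /ev /jz /=.
by field; rewrite e0 gt_eqF.
Qed.

(** At both ends [X j = 0], so the form is [V j ^ 2] times an expression in [x0] and the other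
    velocity entries, all of which return. *)
Lemma functN_return C h : (forall i, a i <= C) ->
  (forall t, 0 <= t <= 1 -> X j t ^+ 2 + V j t ^+ 2 <= h) ->
  h <= a j / 2 -> h <= a j * T ^+ 2 / (4 * C) ->
  1 + mom (gap a j) x0 x0 != 0 -> functN 1 = functN 0.
Proof.
move=> hC hh h1 h2 P0.
have ret := launched_return e_gt0 e_le XV P0 hC hh h1 h2.
have vj := launched_j_sqr XV P0.
have [_ X0 _ X1] := XV.
have y0 : X j 0 = 0 by rewrite -[RHS]x0j -X0.
have y1 : X j 1 = 0 by rewrite -[RHS]x0j -X1.
have [g1 g2] := gap_ext x0 ret; have [g3 g4] := gap_ext2 ret.
rewrite /functN /jNf /jw /jz /jP /jQ /jS /jP2 /jQ2 /jS2 y0 y1 X0 X1 g1 g2 g4.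
rewrite !mulr0 !subr0 !addr0.
set P := 1 + _; set Q := mom _ x0 _; set P2 := mom _ x0 x0; set Q2 := mom _ x0 _.
set S2 := mom _ _ _.
transitivity (V j 1 ^+ 2 * ((Q + k) ^+ 2 * P2 - 2 * P * (Q + k) * Q2 + P ^+ 2 * S2)).
  by ring.
by rewrite vj; ring.
Qed.

Lemma p_start : X j 0 = 0 -> jw a j X V 0 + k * X j 0 = (1 + mom (gap a j) x0 x0) * (T * e).
Proof.
move=> y0; have [_ X0 V0 _] := XV.
have v0 : V j 0 = T * e by rewrite -(vstart_j e) -V0.
by rewrite /jw /jP y0 v0 X0 !mulr0 subr0 addr0.
Qed.

End Rescaling.

(** The form gains at least [r * e ^ 2 * dl] on [[0, dl]] and loses at most [e ^ 4 * M1] on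
    [[0, 1]]; for small [e] this contradicts [functN_return]. *)
Lemma extreme_not_returning : 1 + mom (gap a j) x0 x0 != 0 ->
  ~ returning a x0 T.
Proof.
move=> P0 ret; have [c [C [c0 C0 hc hC]]] := axes_bounds a_gt0 j.
set Pj := 1 + mom _ _ _ in P0.
pose L := T ^+ 2 * c / C; pose U := T ^+ 2 * C / c.
have T2 : 0 < T ^+ 2 by rewrite exprn_gt0.
have L0 : 0 < L by rewrite divr_gt0 // mulr_gt0.
have lb s : admissible s -> forall t, L <= sl s t <= U.
  by move=> [e0 e1 _ h] t; exact: (launched_bounds e0 e1 h t c0 hc hC).
have lU s : admissible s -> forall t, 0 <= sl s t <= U.
  move=> Ds t; have /andP[l1 ->] := lb s Ds t.
  by rewrite (le_trans (ltW L0)).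
have [bE bdp] := bdd_err hC lU.
have [M1 M10 hM1] := bdd_pos bE; have [M2 M20 hM2] := bdd_pos bdp.
pose G := growth U.
have G0 : 0 < G by rewrite mulr_gt0 ?expR_gt0.
pose D0 := mom (gap a j) x0 tau ^+ 2 - Pj * mom (gap a j) tau tau.
have D00 : 0 < D0 := extreme_disc.
(* A lower bound of [kap] independent of [e]: [e <= 1 / 2] gives [3 / 4 <= 1 - e ^ 2]. *)
pose k0 := Num.sqrt (T ^+ 2 * (3 / 4) * D0).
have k00 : 0 < k0 by rewrite sqrtr_gt0 mulr_gt0 // mulr_gt0.
have nP : 0 < `|Pj| by rewrite normr_gt0.
(* Since [p] starts at [Pj * T * e] and varies at rate at most [e * M2], up to time [dl] it keeps at
   least half of its initial size. *)
pose dl := Num.min 1 (`|Pj| * T / (2 * M2)).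
have dl0 : 0 < dl by rewrite lt_min ltr01 divr_gt0 ?mulr_gt0.
have dl1 : dl <= 1 by rewrite ge_min lexx.
have dlM : M2 * dl <= `|Pj| * T / 2.
  apply: (@le_trans _ _ (M2 * (`|Pj| * T / (2 * M2)))).
    by rewrite ler_pM2l // ge_min lexx orbT.
  by rewrite le_eqVlt; apply/orP; left; apply/eqP; field; rewrite gt_eqF.
pose r := 2 * L / a j ^+ 2 * k0 * (`|Pj| * T / 2) ^+ 2.
have r0 : 0 < r.
  have aj2 : 0 < a j ^+ 2 by rewrite exprn_gt0.
  by apply: mulr_gt0; rewrite ?exprn_gt0 ?mulr_gt0 ?divr_gt0 ?mulr_gt0 ?invr_gt0.
pose h := Num.min (a j / 2) (a j * T ^+ 2 / (4 * C)).
have h0 : 0 < h.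
  by rewrite lt_min; apply/andP; split; apply: divr_gt0; rewrite ?mulr_gt0.
(* The three bounds give, in turn, admissibility, a deviation below the threshold [h] of
   [functN_return], and a gain larger than the loss; as [e <= 1], each passes to [e ^ 2]. *)
pose e := Num.min 2^-1 (Num.min (h / G) (r * dl / (2 * M1))).
have e0 : 0 < e.
  rewrite !lt_min invr_gt0 ltr0n /=; apply/andP.
  by split; apply: divr_gt0 => //; apply: mulr_gt0.
have e1 : e <= 2^-1 by rewrite ge_min lexx.
have ee : e ^+ 2 <= e by rewrite expr2 ler_piMl ?(ltW e0) // (le_trans e1) //; lra.
have eG : e ^+ 2 * G <= h.
  by rewrite -ler_pdivlMr // (le_trans ee) // !ge_min lexx orbT.
have eM : e ^+ 2 * M1 < r * dl.
  apply: (@le_lt_trans _ _ (r * dl / 2)); last first.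
    by have := mulr_gt0 r0 dl0; lra.
  rewrite -ler_pdivlMr // (le_trans ee) // (_ : _ / M1 = r * dl / (2 * M1)).
    by rewrite !ge_min lexx !orbT.
  by field; rewrite gt_eqF.
have [X [V [l [hf X0 V0 X1]]]] := ret _ (vstart_tangent e) (vstart_speed e0 e1).
have XV : launched e X V l by split.
pose sn t := Snapshot e X V l t.
have adm t : 0 <= t <= 1 -> admissible (sn t) by move=> t01; split.
have a0 : admissible (sn 0) by apply: adm; rewrite lexx ler01.
have small t : 0 <= t <= 1 -> X j t ^+ 2 + V j t ^+ 2 <= h.
  move=> t01; apply: le_trans eG; exact: launched_small e0 e1 XV (lU _ a0) t01.
have hN : functN e X V l 1 = functN e X V l 0.
  apply: (functN_return e0 e1 XV hC small _ _ P0).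
    by rewrite ge_min lexx.
  by rewrite ge_min lexx orbT.
pose k := kap (sn 0).
have kk : k0 <= k.
  rewrite /k0 /k /kap ler_wsqrtr // (disc_start e0 e1 XV) -/Pj -/D0.
  rewrite ler_pM2r // ler_pM2l //.
  have : e * e <= 2^-1 * 2^-1 by rewrite ler_pM // ltW.
  by rewrite -expr2; lra.
have dN t := d_functN e0 e1 XV t.
have low t : 0 <= t <= 1 -> - (e ^+ 4 * M1) <= speedN e X V l t.
  move=> t01; have := hM1 _ (adm t t01); rewrite ler_norml => /andP[hE _].
  have /andP[l1 _] := lU _ a0 t.
  rewrite /speedN -[leLHS]add0r lerD //.
    rewrite mulr_ge0 ?sqr_ge0 // mulr_ge0 ?sqrtr_ge0 // divr_ge0 ?sqr_ge0 //.
    by rewrite mulr_ge0.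
  by rewrite -mulrN ler_pM2l ?exprn_gt0.
have y0 : X j 0 = 0 by rewrite -[RHS]x0j -X0.
have low2 t : 0 <= t <= dl -> r * e ^+ 2 - e ^+ 4 * M1 <= speedN e X V l t.
  move=> /andP[t0 td]; have t01 : 0 <= t <= 1 by rewrite t0 (le_trans td).
  have := hM1 _ (adm t t01); rewrite ler_norml => /andP[hE _].
  have /andP[l1 _] := lb _ a0 t.
  have hp : `|Pj| * T / 2 * e <= `|e * ep (sn t)|.
    have hd : `|(jw a j X V t + k * X j t) - (jw a j X V 0 + k * X j 0)| <=
        (e * M2) * (t - 0).
      apply: (mvt_norm (d_p e0 XV) t0) => s /andP[s0 st].
      rewrite normrM gtr0_norm // ler_pM2l //; apply: hM2; apply: adm.
      by rewrite s0 (le_trans st) // (le_trans td).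
    rewrite (p_start XV y0) (rescale_p X V l e0) -/Pj in hd.
    have hPj : `|Pj * (T * e)| = `|Pj| * T * e.
      by rewrite normrM [`|T * e|]gtr0_norm ?mulr_gt0 // mulrA.
    have : e * M2 * (t - 0) <= e * (`|Pj| * T / 2).
      rewrite subr0 -mulrA ler_pM2l // (le_trans _ dlM) // ler_pM2l //.
    have := ler_normB (e * ep (sn t)) (e * ep (sn t) - Pj * (T * e)).
    rewrite subKr hPj => z1 z2.
    have -> : `|Pj| * T / 2 * e = `|Pj| * T * e - e * (`|Pj| * T / 2) by field.
    lra.
  rewrite /speedN -[e ^+ 4 * M1]opprK -mulrN opprK lerD //; last first.
    by rewrite ler_pM2l ?exprn_gt0.
  have -> : r * e ^+ 2 = 2 * L / a j ^+ 2 * k0 * (`|Pj| * T / 2 * e) ^+ 2.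
    by rewrite /r; ring.
  have aj2 : 0 < a j ^+ 2 by rewrite exprn_gt0.
  have p1 : 0 <= `|Pj| * T / 2 * e by rewrite !mulr_ge0 ?invr_ge0 // ltW.
  apply: ler_pM; rewrite ?sqr_ge0 //.
  - by rewrite ltW // mulr_gt0 // divr_gt0 // mulr_gt0.
  - apply: ler_pM => //; rewrite ?(ltW k00) //.
      by rewrite ltW // divr_gt0 // mulr_gt0.
    by rewrite ler_pM2r ?invr_gt0 // ler_pM2l.
  - by rewrite -[leRHS]real_normK ?num_real // lerXn2r ?nnegrE.
have i1 := mvt_le dN (ltW dl0) low2.
have i2 : - (e ^+ 4 * M1) * (1 - dl) <= functN e X V l 1 - functN e X V l dl.
  apply: (mvt_le dN dl1) => t /andP[dt t1]; apply: low.
  by rewrite t1 (le_trans (ltW dl0)).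
rewrite -hN in i1.
have : e ^+ 2 * (e ^+ 2 * M1) < e ^+ 2 * (r * dl) by rewrite ltr_pM2l ?exprn_gt0.
rewrite mulrA -exprD => fin.
have : r * e ^+ 2 * dl - e ^+ 4 * M1 <= 0 by lra.
by rewrite subr_le0 leNgt => /negP; apply; rewrite (lt_le_trans fin) // mulrA (mulrC r).
Qed.

End ExtremePlane.

(** * Orthogonal diagonalisation of a symmetric matrix with simple eigenvalues *)

Section Diagonalisation.
Import spectral complex.
Variables (R : realType) (n : nat).
Implicit Types A : 'M[R]_n.

Lemma char_poly_conj (F : fieldType) (B P : 'M[F]_n) : P \in unitmx ->
  char_poly (invmx P *m B *m P) = char_poly B.
Proof.
move=> Pu; have Pc : map_mx polyC (invmx P) *m map_mx polyC P = 1%:M.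
  by rewrite -map_mxM mulVmx // map_mx1.
have e : char_poly_mx (invmx P *m B *m P) =
    map_mx polyC (invmx P) *m char_poly_mx B *m map_mx polyC P.
  rewrite /char_poly_mx mulmxBr mulmxBl !map_mxM; congr (_ - _).
  by rewrite scalar_mxC -mulmxA Pc mulmx1.
rewrite /char_poly e !det_mulmx mulrAC -det_mulmx.
by rewrite Pc det1 mul1r.
Qed.

(** Over the complex numbers the matrix is Hermitian, so the spectral theorem applies and its
    eigenvalues are real. *)
Lemma symmetric_char_poly A : A^T = A ->
  exists r : 'I_n -> R, char_poly A = \prod_i ('X - (r i)%:P).
Proof.
move=> sA; pose Ac : 'M[complex R]_n := map_mx (real_complex R) A.
have Areal : Ac \is a mxOver Num.real.
  by apply/mxOverP => i k; rewrite mxE; apply/complex_realP; exists (A i k).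
have Asym : Ac \is symmetricmx.
  apply/is_hermitianmxP; rewrite expr0 scale1r map_mx_id //.
  by rewrite /Ac map_trmx sA.
have Ah := realsym_hermsym Asym Areal.
have /orthomx_spectralP eA := hermitian_normalmx Ah.
have /mxOverP sreal := hermitian_spectral_diag_real Ah.
exists (fun i => complex.Re (spectral_diag Ac 0 i)).
apply: (@map_poly_inj _ _ (real_complex R)).
rewrite map_char_poly map_prod_XsubC -/Ac {1}eA char_poly_conj ?spectral_unit //.
rewrite char_poly_trig ?diag_mx_is_trig //; apply: eq_bigr => i _.
by rewrite mxE eqxx mulr1n /= RRe_real.
Qed.

Lemma symmetric_diagonalisation A : A^T = A -> simple_eigenvalues A ->
  exists (U : 'M[R]_n) (d : 'I_n -> R), [/\ U *m U^T = 1%:M,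
    U^T *m U = 1%:M, injective d & forall i, row i U *m A = d i *: row i U].
Proof.
move=> sA simple; have [d cA] := symmetric_char_poly sA.
have eig i : eigenvalue A (d i).
  by rewrite eigenvalue_root_char cA rootE (bigD1 i) //= hornerM !hornerE subrr mul0r.
have c0 : char_poly A != 0 by rewrite monic_neq0 ?char_poly_monic.
(* Two equal factors would give a root of multiplicity at least [2]. *)
have d_inj : injective d.
  move=> i k dik; apply/eqP/negPn/negP => ik.
  have := mup_geq (d i) 2 c0; rewrite (simple _ (eig i)) ltnn => /esym/negP; apply.
  rewrite cA (bigD1 i) //= (bigD1 k) 1?eq_sym //= mulrA -dik -expr2.
  exact: dvdp_mulr.
have /choice[v hv] : forall i, exists v : 'rV[R]_n, v *m A = d i *: v /\ v != 0.
  by move=> i; have /eigenvalueP[v vA v0] := eig i; exists v.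
pose N i := (v i *m (v i)^T) 0 0.
have N0 i : 0 < N i.
  rewrite /N mxE lt_neqAle sumr_ge0 ?andbT => [|k _]; last first.
    by rewrite mxE -expr2 sqr_ge0.
  apply/eqP => /esym/eqP h; have /negP := (hv i).2; apply; apply/eqP/rowP => k.
  move: h; rewrite psumr_eq0 => [/allP/(_ k)|l _]; last by rewrite mxE -expr2 sqr_ge0.
  by rewrite mem_index_enum mxE -expr2 sqrf_eq0 mxE => /(_ isT)/eqP.
pose U := \matrix_i ((Num.sqrt (N i))^-1 *: v i).
have rU i : row i U = (Num.sqrt (N i))^-1 *: v i by rewrite rowK.
have eU i : row i U *m A = d i *: row i U.
  by rewrite rU -scalemxAl (hv i).1 !scalerA mulrC.
have UU : U *m U^T = 1%:M.
  apply/matrixP => i k; rewrite !mxE.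
  have -> : \sum_l U i l * U^T l k = (row i U *m (row k U)^T) 0 0.
    by rewrite mxE; apply: eq_bigr => l _; rewrite !mxE.
  have -> : row i U *m (row k U)^T =
      ((Num.sqrt (N i))^-1 * (Num.sqrt (N k))^-1) *: (v i *m (v k)^T).
    by rewrite !rU linearZ /= -scalemxAl -scalemxAr scalerA.
  rewrite mxE; have [<-|ik] := eqVneq i k.
    by rewrite -/(N i) -expr2 exprVn sqr_sqrtr ?(ltW (N0 i)) // mulVf ?gt_eqF.
  have h : d i *: (v i *m (v k)^T) = d k *: (v i *m (v k)^T).
    rewrite scalemxAl -(hv i).1 scalemxAr -linearZ /= -(hv k).1 trmx_mul sA.
    by rewrite mulmxA.
  have /eqP : (d i - d k) *: (v i *m (v k)^T) = 0 by rewrite scalerBl h subrr.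
  rewrite scaler_eq0 subr_eq0 (inj_eq d_inj) (negPf ik) /= => /eqP ->.
  by rewrite mxE mulr0.
exists U, d; split => //; exact: mulmx1C.
Qed.

End Diagonalisation.

(** * From curves on the ellipsoid to principal coordinates *)

Section MatrixDerivative.
Variables (R : realType) (m n : nat).
Implicit Types M : R -> 'M[R]_(m, n).

Lemma is_derive_mx M (L : 'M[R]_(m, n)) (t : R) :
  (forall i k, is_derive t 1 (fun s => M s i k) (L i k)) -> is_derive t 1 M L.
Proof.
move=> h; have dM : derivable M t 1 by apply/derivable_mxP => i k; case: (h i k).
apply: DeriveDef => //; rewrite derive_mx //; apply/matrixP => i k.
by rewrite mxE derive_val.
Qed.

Lemma derivable_entry M (t : R) i k : derivable M t 1 ->
  is_derive t 1 (fun s => M s i k) (derive1 M t i k).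
Proof.
move=> dM; apply: DeriveDef; first exact: (derivable_mxP M t 1).1 dM i k.
by rewrite derive1E derive_mx // mxE.
Qed.

End MatrixDerivative.

Section Coordinates.
Variables (R : realType) (n : nat) (A U : 'M[R]_n) (d : 'I_n -> R).
Hypothesis sA : A^T = A.
Hypothesis pA : positive_definite A.
Hypothesis UUt : U *m U^T = 1%:M.
Hypothesis UtU : U^T *m U = 1%:M.
Hypothesis eU : forall i, row i U *m A = d i *: row i U.

Definition coords (x : 'cV[R]_n) i : R := (U *m x) i 0.
Definition uncoords (v : 'I_n -> R) : 'cV[R]_n := U^T *m \col_i v i.

Lemma uncoordsK v : coords (uncoords v) = v.
Proof.
by apply/funext => i; rewrite /coords /uncoords mulmxA UUt mul1mx mxE.
Qed.

Lemma coordsZ c x i : coords (c *: x) i = c * coords x i.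
Proof. by rewrite /coords -scalemxAr mxE. Qed.

Lemma coords0 i : coords 0 i = 0.
Proof. by rewrite /coords mulmx0 mxE. Qed.

Lemma dot_coords x y : dot x y = mom (fun=> 1) (coords x) (coords y).
Proof.
have dotE u v : dot u v = (u^T *m v) 0 0 :> R.
  by rewrite mxE; apply: eq_bigr => i _; rewrite mxE.
rewrite dotE -[in LHS](mul1mx y) -UtU -mulmxA mulmxA -trmx_mul mxE.
by apply: eq_bigr => i _; rewrite /coords mxE mul1r.
Qed.

Lemma coords_A x i : coords (A *m x) i = d i * coords x i.
Proof.
have rowE B (y : 'cV[R]_n) : (B *m y) i 0 = (row i B *m y) 0 0.
  by rewrite -row_mul [RHS]mxE.
by rewrite /coords mulmxA rowE row_mul eU -scalemxAl mxE -rowE.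
Qed.

Lemma eigenvalues_gt0 i : 0 < d i.
Proof.
pose e k : R := (k == i)%:R; have ee : mom (fun=> 1) e e = 1.
  by rewrite mom_delta mul1r /e eqxx.
have := pA (x := uncoords e); rewrite dot_coords.
have -> : coords (A *m uncoords e) = fun k => d i * e k + 0 * e k.
  apply/funext => k; rewrite coords_A uncoordsK mul0r addr0 /e.
  by case: eqVneq => [->|_]; rewrite ?mulr0.
rewrite uncoordsK mom_comb ee mulr1 mul0r addr0; apply.
apply/eqP => /(congr1 coords); rewrite uncoordsK => /(congr1 (fun f => f i)).
by rewrite coords0 /e eqxx => /eqP; rewrite oner_eq0.
Qed.

Lemma coords_invA x i : coords (invmx A *m x) i = (d i)^-1 * coords x i.
Proof.
(* [invmx] is the inverse only on [unitmx]; invertibility comes from the right inverse [B], built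
   from the reciprocal eigenvalues. *)
have uA : A \in unitmx.
  pose B := U^T *m diag_mx (\row_i (d i)^-1) *m U.
  have : A *m B = 1%:M.
    apply/matrixP => k l; rewrite -[A *m B]mul1mx -UtU -mulmxA.
    have -> : U *m (A *m B) = U.
      apply/row_matrixP => r; rewrite !row_mul mulmxA eU -scalemxAl /B.
      rewrite !mulmxA -row_mul UUt.
      apply/rowP => s; rewrite !mxE mulr_sumr (bigD1 r) //= big1 ?addr0.
        rewrite !mxE (bigD1 r) //= big1 ?addr0 => [|u ur].
          by rewrite !mxE !eqxx !mulr1n mul1r mulrA divff ?mul1r // gt_eqF ?eigenvalues_gt0.
        by rewrite !mxE eq_sym (negPf ur) mul0r.
      move=> u ur; rewrite !mxE big1 ?mul0r ?mulr0 // => w _.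
      rewrite !mxE; have [<-|rw] := eqVneq r w; last by rewrite mul0r.
      by rewrite eq_sym (negPf ur) mulr0n mulr0.
    by rewrite UtU.
  by case/mulmx1_unit.
have := coords_A (invmx A *m x) i; rewrite mulmxA mulmxV // mul1mx => ->.
by rewrite mulKf // gt_eqF ?eigenvalues_gt0.
Qed.

Lemma dot_invA x y :
  dot (invmx A *m x) y = mom (fun i => (d i)^-1) (coords x) (coords y).
Proof.
by rewrite dot_coords; apply: eq_bigr => i _; rewrite coords_invA mul1r.
Qed.

(* The curve is [x + t v] rescaled back to the ellipsoid. *)
Lemma tangent_ellipsoid x v : ellipsoid A x -> dot (invmx A *m x) v = 0 ->
  tangent (ellipsoid A) x v.
Proof.
rewrite /ellipsoid /= !dot_invA => xE xv.
pose b := mom (fun i => (d i)^-1) (coords v) (coords v).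
have b0 : 0 <= b.
  by apply: mom_ge0 => i; rewrite invr_ge0 ltW ?eigenvalues_gt0.
pose r (t : R) := 1 + b * t ^+ 2.
have r0 t : 0 < r t by rewrite ltr_pwDl // mulr_ge0 // sqr_ge0.
pose f t := (Num.sqrt (r t))^-1.
exists (fun t => f t *: (x + t *: v)); split.
- near=> t; rewrite /ellipsoid /= dot_invA.
  have -> : coords (f t *: (x + t *: v)) = fun i => f t * coords x i + f t * t * coords v i.
    by apply/funext => i; rewrite /coords -scalemxAr mulmxDr -scalemxAr !mxE; ring.
  rewrite mom_sqr xE xv -/b.
  transitivity (f t ^+ 2 * r t); first by rewrite /r; ring.
  by rewrite /f exprVn sqr_sqrtr ?(ltW (r0 t)) // mulVf ?gt_eqF.
- by rewrite scale0r addr0 /f /r expr0n mulr0 addr0 sqrtr1 invr1 scale1r.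
- have df : is_derive (0 : R) 1 f 0.
    have dr : is_derive (0 : R) 1 r 0.
      have hi := fun t : R => is_derive_id t (1 : R).
      by rewrite /r; deriv; ring.
    have ds : is_derive (0 : R) 1 (fun t => Num.sqrt (r t)) 0.
      have := is_derive1_comp (is_derive1_sqrt (r0 0)) dr.
      by rewrite mulr0.
    apply: (is_derive_eqf (is_derive_invf _ ds)); last by rewrite mulr0.
    by rewrite gt_eqF // sqrtr_gt0.
  apply: is_derive_mx => i k.
  have f0 : f 0 = 1 by rewrite /f /r expr0n mulr0 addr0 sqrtr1 invr1.
  have -> : (fun s : R => (f s *: (x + s *: v)) i k) = fun s => f s * (x i k + s * v i k).
    by apply/funext => s; rewrite !mxE.
  have dl : is_derive (0 : R) 1 (fun s => x i k + s * v i k) (v i k).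
    have hi := fun t : R => is_derive_id t (1 : R).
    by deriv; ring.
  by apply: (is_derive_eqf (is_derive_mulf df dl)); rewrite f0 mul1r mulr0 addr0.
Unshelve. all: by end_near. Qed.

Lemma coords_derive (g : R -> 'cV[R]_n) i (t : R) : derivable g t 1 ->
  is_derive t 1 (fun s => coords (g s) i) (coords (derive1 g t) i).
Proof.
move=> dg.
have -> : (fun s => coords (g s) i) = fun s => \sum_k U i k * g s k 0.
  by apply/funext => s; rewrite /coords mxE.
rewrite /coords mxE; apply: is_derive_sumf => k.
apply: (is_derive_eqf (is_derive_mulf (is_derive_cstf _ _) (derivable_entry k 0 dg))).
by rewrite mulr0 addr0.
Qed.

(** The acceleration is orthogonal to the tangent space, hence a multiple [c] of the normal [N],
    whose squared length is [w t]; the multiplier [l] is [- c]. *)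
Lemma geodesic_flow (g : R -> 'cV[R]_n) : geodesic (ellipsoid A) g ->
  exists l, flow d (fun i t => coords (g t) i) (fun i t => coords (derive1 g t) i) l.
Proof.
case=> gE dg dg' hg.
pose X t := coords (g t); pose G t := coords (derive1 (derive1 g) t).
pose w t := mom (fun i => (d i)^-1 ^+ 2) (X t) (X t).
pose l t := - mom (fun i => (d i)^-1) (X t) (G t) / w t.
have on t : mom (fun i => (d i)^-1) (X t) (X t) = 1.
  by have := gE t; rewrite /ellipsoid /= dot_invA.
have GX t i : G t i = - (l t / d i) * X t i.
  pose c := mom (fun i => (d i)^-1) (X t) (G t) / w t.
  pose N i := (d i)^-1 * X t i.
  have NN : mom (fun=> 1) N N = w t.
    by apply: eq_bigr => k _; rewrite /N; ring.
  have GN y : mom (fun=> 1) N y = mom (fun i => (d i)^-1) (X t) y.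
    by apply: eq_bigr => k _; rewrite /N; ring.
  have w0 : w t != 0.
    apply/eqP => w0; have N0 k : N k = 0.
      by apply/eqP; rewrite -sqrf_eq0 eq_le sqr_ge0 -w0 -NN sqr_le_mom1.
    have := on t; rewrite -GN /mom big1 => [/eqP|k _].
      by rewrite eq_sym oner_eq0.
    by rewrite N0 mulr0 mul0r.
  (* The tangential part of [G t]: orthogonal to [N] by the choice of [c] and to [G t] as [g] is a
     geodesic, hence to itself, hence zero. *)
  pose v k := 1 * G t k + (- c) * N k.
  have tv : mom (fun i => (d i)^-1) (X t) v = 0.
    rewrite -GN momC mom_comb (momC _ (G t)) GN NN /c mulNr divfK // mul1r.
    by rewrite subrr.
  have Gv : mom (fun=> 1) (G t) v = 0.
    have [_ /(_ (uncoords v))] := hg t.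
    rewrite subr0 dot_coords uncoordsK; apply.
    by apply: tangent_ellipsoid => //; rewrite dot_invA uncoordsK.
  have vv : mom (fun=> 1) v v = 0 by rewrite mom_comb Gv GN tv !mulr0 addr0.
  have vi : v i = 0 by apply/eqP; rewrite -sqrf_eq0 eq_le sqr_ge0 -vv sqr_le_mom1.
  have -> : G t i = c * N i by rewrite -[RHS]add0r -vi /v; ring.
  by rewrite /l /N /c; ring.
exists l; split => //.
- by move=> i t; exact: coords_derive.
- by move=> i t; apply: (is_derive_eqf (coords_derive i (dg' t))); exact: GX.
Qed.

Lemma self_focal_returning x0 : self_focal (ellipsoid A) x0 ->
  exists2 T, 0 < T & returning d (coords x0) T.
Proof.
move=> [x0E [T [T0 hT]]]; exists T => // v tv nv.
pose xi := T^-1 *: uncoords v.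
have x0n : x0 != 0.
  apply/eqP => z; move: x0E; rewrite /ellipsoid /= dot_invA z.
  rewrite (_ : mom _ _ _ = 0); first by move/eqP; rewrite eq_sym oner_eq0.
  by rewrite /mom big1 // => i _; rewrite coords0 mulr0.
have cxi i : coords xi i = T^-1 * v i by rewrite coordsZ uncoordsK.
have txi : tangent (ellipsoid A) x0 xi.
  apply: tangent_ellipsoid => //; rewrite dot_invA.
  rewrite -[RHS](mulr0 T^-1) -tv mulr_sumr; apply: eq_bigr => i _.
  by rewrite cxi; ring.
have nxi : dot xi xi = 1.
  rewrite dot_coords.
  have -> : mom (fun=> 1) (coords xi) (coords xi) =
      T^-1 ^+ 2 * mom (fun=> 1) v v.
    by rewrite mulr_sumr; apply: eq_bigr => i _; rewrite !cxi; ring.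
  by rewrite nv exprVn mulVf // expf_eq0 /= gt_eqF.
(* [exp_map] would be [0], which is not on the ellipsoid, if there were no
   geodesic. *)
have := hT _ txi nxi; rewrite /exp_map.
case: xgetP => [y -> [g [geo g0 dg0 g1]] yx|_ z]; last first.
  by rewrite -z eqxx in x0n.
have [l fl] := geodesic_flow geo.
exists (fun i t => coords (g t) i), (fun i t => coords (derive1 g t) i), l.
split => //.
- by rewrite g0.
- by rewrite dg0; apply/funext => i; rewrite coordsZ cxi mulVKf // gt_eqF.
- by rewrite g1 yx.
Qed.

End Coordinates.

(* Hence [P] vanishes at [x0] for at most one middle axis. *)
Lemma focal_gap_decreasing (R : realType) n (a x0 : 'I_n -> R) p q j k :
  mom (fun i => (a i)^-1) x0 x0 = 1 ->
  (forall i, i != p -> i != q -> x0 i = 0) ->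
  a p < a j -> a j < a k -> a k < a q ->
  mom (gap a k) x0 x0 < mom (gap a j) x0 x0.
Proof.
move=> on supp pj jk kq.
have pq : p != q.
  by apply/eqP => e; move: (lt_trans pj (lt_trans jk kq)); rewrite e ltxx.
have z i : i != p -> i != q -> x0 i * x0 i = 0 by move=> ip iq; rewrite supp ?mul0r.
rewrite !(mom_supp2 _ pq z) -subr_gt0.
have gp : 0 < gap a j p - gap a k p.
  by rewrite subr_gt0 ltf_pV2 ?posrE ?subr_gt0 ?ltrD2r // (lt_trans pj).
have gq : 0 < gap a j q - gap a k q.
  by rewrite subr_gt0 ltf_nV2 ?negrE ?subr_lt0 ?ltrD2r // (lt_trans jk).
rewrite (_ : _ - _ = (gap a j p - gap a k p) * x0 p ^+ 2 +
                     (gap a j q - gap a k q) * x0 q ^+ 2); last by ring.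
have [xp|xp] := eqVneq (x0 p) 0; last first.
  apply: ltr_pwDl; [apply: mulr_gt0 | apply: mulr_ge0]; rewrite ?(ltW gq) ?sqr_ge0 //.
  by rewrite exprn_even_gt0.
have [xq|xq] := eqVneq (x0 q) 0; last first.
  apply: ltr_wpDl; [apply: mulr_ge0 | apply: mulr_gt0]; rewrite ?(ltW gp) ?sqr_ge0 //.
  by rewrite exprn_even_gt0.
by move/eqP: on; rewrite (mom_supp2 _ pq z) xp xq !mulr0 addr0 eq_sym oner_eq0.
Qed.

Theorem theorem0p4 (R : realType) (n : nat) (hn : (4 <= n)%N) (A : 'M[R]_n)
    (hsym : A^T = A) (hpos : positive_definite A)
    (hsimple : simple_eigenvalues A) :
  ~ exists x0 : 'cV[R]_n, self_focal (ellipsoid A) x0.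
Proof.
move=> [x focal].
have [U [a [UUt UtU a_inj eU]]] := symmetric_diagonalisation hsym hsimple.
have a_gt0 := eigenvalues_gt0 hpos UUt UtU eU.
have [T T0 ret] := self_focal_returning hpos UUt UtU eU focal.
set x0 := coords U x in ret.
have on : mom (fun i => (a i)^-1) x0 x0 = 1.
  by case: focal => + _; rewrite /ellipsoid /= (dot_invA hpos UUt UtU eU).
have i0 : 'I_n by exists 0%N; exact: leq_trans hn.
pose p := [arg min_(i < i0) a i]%O; pose q := [arg max_(i > i0) a i]%O.
have pmin i : i != p -> a p < a i.
  move=> ip; rewrite lt_neqAle (inj_eq a_inj) eq_sym ip /p /=.
  by case: arg_minP => // k _; exact.
have qmax i : i != q -> a i < a q.
  move=> iq; rewrite lt_neqAle (inj_eq a_inj) iq /q /=.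
  by case: arg_maxP => // k _; exact.
have supp i : i != p -> i != q -> x0 i = 0.
  move=> ip iq; exact: (returning_middle a_gt0 a_inj T0 on (pmin i ip) (qmax i iq) ret).
(* As [n >= 4], at least two axes remain besides [p] and [q]. *)
have [j [k [[jp jq] [kp kq] jk]]] : exists j k, [/\ j != p /\ j != q,
    k != p /\ k != q & a j < a k].
  pose S := [set: 'I_n] :\ p :\ q.
  have cS : (1 < #|S|)%N.
    have := cardsD1 q ([set: 'I_n] :\ p); have := cardsD1 p [set: 'I_n].
    rewrite cardsT card_ord -/S => e1 e2; rewrite -(leq_add2l 2) (leq_trans hn) //.
    by rewrite [X in (X <= _)%N]e1 e2 addnA leq_add2r (leq_add (leq_b1 _) (leq_b1 _)).
  have /card_gt1P[j [k [jS kS jk]]] := cS.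
  move: jS kS; rewrite !inE !andbT => /andP[jq jp] /andP[kq kp].
  have [h|h|/a_inj h] := ltgtP (a j) (a k).
  - by exists j, k.
  - by exists k, j.
  - by rewrite h eqxx in jk.
have [tau [t1 t2 t3]] := extreme_tangent on supp (pmin j jp) (qmax j jq).
have gt := focal_gap_decreasing on supp (pmin j jp) jk (qmax k kq).
(* If the focal quantity vanishes for [j], it is negative for [k], which then takes the place of
   [j]. *)
have [Pj|Pj] := eqVneq (1 + mom (gap a j) x0 x0) 0.
  have Pk : 1 + mom (gap a k) x0 x0 != 0.
    by rewrite lt_eqF // -Pj ltrD2l.
  exact: (extreme_not_returning a_gt0 a_inj T0 on supp (pmin k kp) (qmax k kq)
    t1 t2 t3 Pk ret).
exact: (extreme_not_returning a_gt0 a_inj T0 on supp (pmin j jp) (qmax j jq)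
  t1 t2 t3 Pj ret).
Qed.
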